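(* Let $k$ be a field. Let $(E,R)$ be a finite poset and let $V$ be a simple left $k\mathrm{Aut}(E,R)$-module. Let $T$ be a finite lattice such that $\mathrm{Irr}(T)=(E,R)$ and such that the restriction homomorphism $\mathrm{Aut}(T)\to\mathrm{Aut}(E,R)$ is an isomorphism. Let $G=E\sqcup\{t\in T\mid t=r^\infty(\sigma^\infty(t))\}\subseteq T$. For any finite set $X$, the dimension of $S_{E,R^{op},V}(X)$ is given by $$\dim_kS_{E,R^{op},V}(X)=\frac{\dim_kV}{|\mathrm{Aut}(E,R)|}\sum_{i=0}^{|E|}(-1)^i\binom{|E|}{i}(|G|-i)^{|X|}.$$
   Context: **Lattices.** In a finite lattice $T$ (least element $\hat0$, greatest element $\hat1$), an element $e$ is irreducible if $e=\bigvee_{a\in A}a$ with $A\subseteq T$ implies $e\in A$ (so $\hat0$ is not irreducible). $\mathrm{Irr}(T)=(E,R)$ denotes the set $E$ of irreducible elements with the order $R$ induced from $T$; $R^{op}$ is the opposite order; note $\mathrm{Aut}(E,R)=\mathrm{Aut}(E,R^{op})$. For $t\in T$: $r(t)$ is the join of all elements strictly smaller than $t$, and $r^\infty(t)$ is the stable value of the iterates $r^n(t)$; $\sigma(t)$ is the meet of all irreducible elements strictly larger than $t$ (empty meet $=\hat1$), and $\sigma^\infty(t)$ is the stable value of the iterates $\sigma^n(t)$. **Correspondences.** For finite sets $X,Y$, $\mathcal{C}(Y,X)$ is the set of all subsets of $Y\times X$; composition of $S\subseteq Z\times Y$ and $Q\subseteq Y\times X$ is $SQ=\{(z,x)\mid\exists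 y\in Y,\ (z,y)\in S,\ (y,x)\in Q\}$. $k\mathcal{C}(Y,X)$ is the free $k$-module on $\mathcal{C}(Y,X)$, with bilinear composition; $k\mathcal{C}(E,E)$ is a $k$-algebra. $\Delta_E=\{(e,e)\mid e\in E\}$ and, for a permutation $\alpha$ of $E$, $\Delta_\alpha=\{(\alpha(e),e)\mid e\in E\}$. A correspondence functor is a $k$-linear functor from the category with objects the finite sets and morphisms $X\to Y$ the elements of $k\mathcal{C}(Y,X)$, to $k$-modules. **The functors $S_{E,R,V}$.** For a finite poset $(E,R)$, the fundamental module $\mathcal{P}_Ef_R$ is the left $k\mathcal{C}(E,E)$-module which is $k$-free with basis $\{\Delta_\alpha f_R\}$, $\alpha$ running over the permutations of $E$, where a relation $Q\in\mathcal{C}(E,E)$ acts by $Q\cdot\Delta_\alpha f_R=\Delta_{\beta\alpha}f_R$ if there is a (necessarily unique) permutation $\beta$ with $\Delta_E\subseteq\Delta_{\beta^{-1}}Q\subseteq{}^{\alpha}R:=\{(\alpha(e),\alpha(f))\mid(e,f)\in R\}$, and $Q\cdot\Delta_\alpha f_R=0$ otherwise. It is a bimodule with right action of $\tau\in\mathrm{Aut}(E,R)$ given by $\Delta_\alpha f_R\cdot\tau=\Delta_{\alpha\tau}f_R$. For a left $k\mathcal{C}(E,E)$-module $W$, $L_{E,W}(X)=k\mathcal{C}(X,E)\otimes_{k\mathcal{C}(E,E)}W$ and $J_{E,W}(X)=\{\sum_i\varphi_i\otimes w_i\mid\forall\rho\in k\mathcal{C}(E,X),\ \sum_i(\rho\varphi_i)\cdot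 w_i=0\}$; these are correspondence functors via left composition. For a left $k\mathrm{Aut}(E,R)$-module $V$, $S_{E,R,V}=L_{E,W}/J_{E,W}$ with $W=\mathcal{P}_Ef_R\otimes_{k\mathrm{Aut}(E,R)}V$. The functor $S_{E,R^{op},V}$ is the same construction applied to the poset $(E,R^{op})$. (For $k$ a field and $V$ simple, this is a simple correspondence functor.) *)

(* Defs.v *)
From HB Require Import structures.
From mathcomp Require Import all_boot all_order all_algebra all_fingroup.
From mathcomp Require Import mxrepresentation.

Set Implicit Arguments.
Unset Strict Implicit.
Unset Printing Implicit Defensive.

Import Order.TTheory GRing.Theory.
Local Open Scope ring_scope.

Lemma linfunE (k : fieldType) (U V : vectType k) (f : U -> V) :
  linear f -> linfun f =1 f.
Proof.
move=> lin u; pose F : {linear U -> V} := HB.pack f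
  (GRing.isLinear.Build _ _ _ _ f lin).
by rewrite -[f]/(F : U -> V) lfunE.
Qed.

Lemma linear_scale (k : fieldType) (U V : vectType k) (f : U -> V) :
  linear f -> forall (a : k) u, f (a *: u) = a *: f u.
Proof. by move=> lin a u; rewrite -!(linfunE lin) linearZ. Qed.

Lemma linear_comb (k : fieldType) (U V : vectType k) (f : U -> V) :
  linear f -> forall (I : finType) (a : I -> k) (v : I -> U),
  f (\sum_i a i *: v i) = \sum_i a i *: f (v i).
Proof.
move=> lin I a v; rewrite -(linfunE lin) linear_sum.
by apply: eq_bigr => i _; rewrite linearZ /= linfunE.
Qed.

Section Quotient.
Variables (k : fieldType) (vT : vectType k).

(* MathComp has no quotient of a vectType.  We take a complement of U as the
   carrier, together with the projection along U: [quot_proj_eq0] and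
   [quot_reprK] say that this is a linear surjection with kernel U. *)
Definition quotv (U : {vspace vT}) : vectType k := subvs_of U^C%VS.

Definition quot_proj (U : {vspace vT}) : 'Hom(vT, quotv U) :=
  (linfun (@vsproj k vT U^C%VS) \o daddv_pi U^C%VS U)%VF.

Definition quot_repr (U : {vspace vT}) : 'Hom(quotv U, vT) :=
  linfun (@vsval k vT U^C%VS).

Lemma capvC_compl (U : {vspace vT}) : (U^C :&: U = 0)%VS.
Proof. by rewrite capvC capv_compl. Qed.

Lemma quot_reprK (U : {vspace vT}) : cancel (quot_repr U) (quot_proj U).
Proof.
move=> x; rewrite /quot_proj /quot_repr comp_lfunE !lfunE /=.
by rewrite daddv_pi_id ?capvC_compl ?subvsP // vsvalK.
Qed.

Lemma quot_proj_eq0 (U : {vspace vT}) v : (quot_proj U v == 0) = (v \in U).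
Proof.
rewrite /quot_proj comp_lfunE lfunE /=.
have dec := daddv_pi_add (capvC_compl U) (w := v).
rewrite addvC addv_complf memvf in dec; have {}dec := dec isT.
apply/eqP/idP => [h | vU].
  have := congr1 vsval h; rewrite vsprojK ?memv_pi // => h0.
  by rewrite -dec h0 add0r memv_pi.
apply: val_inj; rewrite /= vsprojK ?memv_pi //.
have /eqP := dec; rewrite (daddv_pi_id (capv_compl U)) //.
by rewrite -subr_eq0 addrK => /eqP.
Qed.

End Quotient.

Section QuotientMap.
Variables (k : fieldType) (vT wT : vectType k).
Variables (U : {vspace vT}) (U' : {vspace wT}) (g : 'Hom(vT, wT)).

Definition quot_map : 'Hom(quotv U, quotv U') :=
  (quot_proj U' \o g \o quot_repr U)%VF.

Lemma quot_mapE :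
  (forall v, v \in U -> g v \in U') ->
  forall v, quot_map (quot_proj U v) = quot_proj U' (g v).
Proof.
move=> gU v; rewrite /quot_map 2!comp_lfunE.
have inU : quot_repr U (quot_proj U v) - v \in U.
  by rewrite -quot_proj_eq0 linearB /= quot_reprK subrr.
have := gU _ inU; rewrite -quot_proj_eq0 !linearB /= subr_eq0.
by move/eqP.
Qed.

End QuotientMap.

(* The tensor product over k of U and W, modelled by matrices in the
   coordinates of U and W; [tens_liftE] and [tens_span] say that [tens] is a
   universal bilinear map. *)
Section Tensor.
Variables (k : fieldType) (U W : vectType k).

Definition tensor : vectType k := 'M[k]_(\dim {:U}, \dim {:W}).

Definition tens (u : U) (w : W) : tensor :=
  \matrix_(i, j) (coord (vbasis {:U}) i u * coord (vbasis {:W}) j w).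

Definition tens_lift (Z : vectType k) (b : U -> W -> Z) : 'Hom(tensor, Z) :=
  linfun (fun t : 'M[k]_(\dim {:U}, \dim {:W}) =>
    \sum_i \sum_j t i j *: b (vbasis {:U})`_i (vbasis {:W})`_j).

Definition bilin (Z : vectType k) (b : U -> W -> Z) : Prop :=
  (forall w, linear (b^~ w)) /\ (forall u, linear (b u)).

Lemma tens_bilin : bilin tens.
Proof.
split=> [w a u u' | u a w w']; apply/matrixP=> i j; rewrite !mxE linearP /=.
  by rewrite mulrDl mulrA.
by rewrite mulrDr mulrCA.
Qed.

Lemma tens_span (t : tensor) :
  t = \sum_i \sum_j t i j *: tens (vbasis {:U})`_i (vbasis {:W})`_j.
Proof.
apply/matrixP=> a b; rewrite summxE (bigD1 a) //= summxE (bigD1 b) //=.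
have fU := basis_free (vbasisP {:U}); have fW := basis_free (vbasisP {:W}).
rewrite !mxE !coord_free // !eqxx !mulr1 big1 ?addr0 ?big1 ?addr0 //.
- move=> i ia; rewrite summxE big1 // => j _.
  by rewrite !mxE !coord_free // (negbTE ia) mul0r mulr0.
- move=> j jb; rewrite !mxE !coord_free //.
  by rewrite (negbTE jb) !mulr0.
Qed.

Lemma tens_liftE (Z : vectType k) (b : U -> W -> Z) :
  bilin b -> forall u w, tens_lift b (tens u w) = b u w.
Proof.
case=> bl br u w.
have lin : linear (fun t : 'M[k]_(\dim {:U}, \dim {:W}) =>
    \sum_i \sum_j t i j *: b (vbasis {:U})`_i (vbasis {:W})`_j).
  move=> a t t'; rewrite scaler_sumr -big_split; apply: eq_bigr => i _ /=.
  rewrite scaler_sumr -big_split; apply: eq_bigr => j _ /=.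
  by rewrite !mxE scalerDl scalerA.
rewrite /tens_lift (linfunE lin) [in RHS](coord_vbasis (memvf u)).
rewrite (linear_comb (bl w)); apply: eq_bigr => i _.
rewrite [in RHS](coord_vbasis (memvf w)) (linear_comb (br _)) scaler_sumr.
by apply: eq_bigr => j _; rewrite mxE scalerA.
Qed.

End Tensor.

Definition tens_map (k : fieldType) (U W U' W' : vectType k)
    (f : 'Hom(U, U')) (g : 'Hom(W, W')) : 'Hom(tensor U W, tensor U' W') :=
  tens_lift (fun u w => tens (f u) (g w)).

Lemma tens_mapE (k : fieldType) (U W U' W' : vectType k)
    (f : 'Hom(U, U')) (g : 'Hom(W, W')) u w :
  tens_map f g (tens u w) = tens (f u) (g w).
Proof.
apply: tens_liftE; have [tl tr] := tens_bilin U' W'.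
by split=> [w' a u1 u2 | u' a w1 w2]; rewrite linearP (tl, tr).
Qed.

Lemma tens_ext (k : fieldType) (U W Z : vectType k)
    (f g : 'Hom(tensor U W, Z)) :
  (forall u w, f (tens u w) = g (tens u w)) -> f = g.
Proof.
move=> fg; apply/lfunP=> t; rewrite [t]tens_span !linear_sum /=.
apply: eq_bigr => i _; rewrite !linear_sum /=.
by apply: eq_bigr => j _; rewrite !linearZ /= fg.
Qed.

(* Tensor product over the algebra kD of a finite monoid D (a submonoid of I,
   acting on the right of U by [ra] and on the left of W by [la]).  Since
   D is a k-basis of kD, the relations for kD are spanned by the elements
   (u d) (x) w - u (x) (d w) with d in D, i.e. by the images of the maps
   (_ d) (x) id - id (x) (d _). *)
Section BalancedTensor.
Variables (k : fieldType) (I : finType) (D : {pred I}) (U W : vectType k).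
Variables (ra : I -> 'End(U)) (la : I -> 'End(W)).

Definition bal_rel : {vspace tensor U W} :=
  (\sum_(d in D) limg (tens_map (ra d) \1 - tens_map \1 (la d)))%VS.

Definition btensor : vectType k := quotv bal_rel.

Definition btens (u : U) (w : W) : btensor := quot_proj bal_rel (tens u w).

Lemma btens_bal d u w : d \in D -> btens (ra d u) w = btens u (la d w).
Proof.
move=> dD; apply/eqP; rewrite /btens -subr_eq0 -linearB quot_proj_eq0.
apply/(subvP (sumv_sup d dD (subvv _))).
have -> : tens (ra d u) w - tens u (la d w) =
    (tens_map (ra d) \1 - tens_map \1 (la d))%VF (tens u w).
  by rewrite !lfun_simp !tens_mapE !lfun_simp.
exact: memv_img (memvf _).
Qed.

End BalancedTensor.

(* The free k-module on a finite set I, and linear maps out of it. *)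
Section Free.
Variables (k : fieldType) (I : finType).

Definition freemod : vectType k := {ffun I -> k^o}.

Definition fbase (i : I) : freemod := [ffun j => (j == i)%:R].

Definition flin (W : vectType k) (f : I -> W) : 'Hom(freemod, W) :=
  linfun (fun a : {ffun I -> k^o} => \sum_i (a i : k) *: f i).

Lemma flinE (W : vectType k) (f : I -> W) (a : freemod) :
  flin f a = \sum_i ((a : {ffun I -> k^o}) i : k) *: f i.
Proof.
have lin : linear (fun a : {ffun I -> k^o} => \sum_i (a i : k) *: f i).
  move=> c u v; rewrite scaler_sumr -big_split; apply: eq_bigr => i _ /=.
  by rewrite !ffunE scalerDl scalerA.
by rewrite /flin (linfunE lin).
Qed.

Lemma flin_base (W : vectType k) (f : I -> W) i : flin f (fbase i) = f i.
Proof.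
rewrite flinE (bigD1 i) //= ffunE eqxx scale1r big1 ?addr0 // => j ji.
by rewrite ffunE (negbTE ji) scale0r.
Qed.

Lemma freemod_span (a : freemod) :
  a = \sum_i ((a : {ffun I -> k^o}) i : k) *: fbase i.
Proof.
apply/ffunP=> j; rewrite sum_ffunE (bigD1 j) //= !ffunE eqxx /=.
rewrite big1 => [|i ij]; first by rewrite addr0 [_ *: _]mulr1.
by rewrite !ffunE eq_sym (negbTE ij) [_ *: _]mulr0.
Qed.

End Free.

(* [corr Y X] consists of the subsets of Y * X; it is read as a set of
   morphisms from X to Y. *)
Notation corr Y X := {set Y * X}.
Notation kcorr k Y X := (freemod k (corr Y X)).

Section Correspondences.
Variable k : fieldType.

Definition corr_comp (Z Y X : finType) (S : corr Z Y) (Q : corr Y X) :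
    corr Z X :=
  [set p | [exists y, ((p.1, y) \in S) && ((y, p.2) \in Q)]].

Definition kcomp (Z Y X : finType) (a : kcorr k Z Y) (b : kcorr k Y X) :
    kcorr k Z X :=
  flin (fun S => flin (fun Q => fbase k (corr_comp S Q)) b) a.

Definition diag (E : finType) : corr E E := [set (e, e) | e : E].

Definition diag_perm (E : finType) (s : {perm E}) : corr E E :=
  [set (s e, e) | e : E].

(* A left kC(E,E)-module is a space W with an action [act] of C(E,E), extended
   linearly to kC(E,E) by [kact]. *)
Section Functors.
Variables (E : finType) (W : vectType k) (act : corr E E -> 'End(W)).

Definition kact (a : kcorr k E E) (w : W) : W := flin (fun Q => act Q w) a.

Definition corr_ract (X : finType) (Q : corr E E) : 'End(kcorr k X E) :=
  flin (fun S : corr X E => fbase k (corr_comp S Q)).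

Definition Lfun (X : finType) : vectType k :=
  btensor predT (@corr_ract X) act.

Definition Ltens (X : finType) (phi : kcorr k X E) (w : W) : Lfun X :=
  btens predT (@corr_ract X) act phi w.

Definition Jeval (X : finType) (rho : kcorr k E X) :
    'Hom(tensor (kcorr k X E) W, W) :=
  tens_lift (fun phi w => kact (kcomp rho phi) w).

(* It is enough to test the rho in the basis C(E,X), see [JfunP]. *)
Definition Jfun (X : finType) : {vspace Lfun X} :=
  (quot_proj _ @: \bigcap_(rho : corr E X) lker (Jeval (fbase k rho)))%VS.

Definition LJfun (X : finType) : vectType k := quotv (Jfun X).

Lemma kact_linear w : linear (kact^~ w).
Proof. by move=> c a b; rewrite /kact linearP. Qed.

Lemma kact_bilin : bilin kact.
Proof.
split=> [|a]; first exact: kact_linear.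
move=> c w w'; rewrite /kact !flinE scaler_sumr -big_split.
by apply: eq_bigr => Q _; rewrite linearP scalerDr !scalerA mulrC.
Qed.

Lemma kcomp_bilin (Z Y X : finType) : bilin (@kcomp Z Y X).
Proof.
split=> [b|a]; first by move=> c a a'; rewrite /kcomp linearP.
move=> c b b'; rewrite /kcomp !flinE scaler_sumr -big_split.
by apply: eq_bigr => S _; rewrite linearP scalerDr !scalerA mulrC.
Qed.

Lemma JevalE (X : finType) (rho : kcorr k E X) phi w :
  Jeval rho (tens phi w) = kact (kcomp rho phi) w.
Proof.
apply: (tens_liftE (b := fun phi w => kact (kcomp rho phi) w)).
have [al ar] := kact_bilin; have [cl cr] := @kcomp_bilin E X E.
by split=> [v|a] c x y; [rewrite cr al | rewrite ar].
Qed.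

Lemma Ltens_bal (X : finType) (phi : kcorr k X E) (a : kcorr k E E) w :
  Ltens (kcomp phi a) w = Ltens phi (kact a w).
Proof.
have [tl tr] := tens_bilin (kcorr k X E) W.
have Ll v : linear (@Ltens X ^~ v).
  by move=> c x y; rewrite /Ltens /btens tl linearP.
have Lr x : linear (@Ltens X x).
  by move=> c v v'; rewrite /Ltens /btens tr linearP.
have [cl cr] := @kcomp_bilin X E E; have [al ar] := kact_bilin.
rewrite [a]freemod_span (linear_comb (cr _)) (linear_comb (al _)).
rewrite (linear_comb (Ll _)) (linear_comb (Lr _)); apply: eq_bigr => Q _.
congr (_ *: _); rewrite /kact flin_base /Ltens -btens_bal //.
congr btens; rewrite /kcomp /corr_ract !flinE.
by apply: eq_bigr => S _; rewrite flin_base.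
Qed.

Lemma JfunP (X : finType) (x : Lfun X) :
  x \in Jfun X <->
  exists s : seq (kcorr k X E * W),
    x = \sum_(p <- s) Ltens p.1 p.2 /\
    forall rho : kcorr k E X, \sum_(p <- s) kact (kcomp rho p.1) p.2 = 0.
Proof.
have Jsum (s : seq (kcorr k X E * W)) rho :
    Jeval rho (\sum_(p <- s) tens p.1 p.2) =
    \sum_(p <- s) kact (kcomp rho p.1) p.2.
  by rewrite linear_sum; apply: eq_bigr => p _ /=; rewrite JevalE.
have Lsum (s : seq (kcorr k X E * W)) :
    quot_proj _ (\sum_(p <- s) tens p.1 p.2) = \sum_(p <- s) Ltens p.1 p.2
    :> Lfun X.
  by rewrite linear_sum.
split=> [/memv_imgP[t tJ ->]|[s [-> sJ]]]; last first.
  rewrite -Lsum memv_img //; apply/subvP: (memv_line (\sum_(p <- s) tens p.1 p.2)).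
  by apply/subv_bigcapP=> rho _; rewrite -memvE memv_ker Jsum sJ.
pose s := [seq ((t p.1 p.2 *: (vbasis {:kcorr k X E})`_p.1 : kcorr k X E),
                ((vbasis {:W})`_p.2 : W)) | p <- enum setT].
have ts : t = \sum_(p <- s) tens p.1 p.2.
  rewrite [LHS]tens_span pair_big big_map big_enum /=.
  apply: eq_big => [p|p _]; first by rewrite inE.
  have [tl _] := tens_bilin (kcorr k X E) W.
  by rewrite (linear_scale (tl _)).
exists s; split=> [|rho]; first by rewrite ts Lsum.
rewrite -Jsum -ts [t]ts Jsum.
have [cl _] := @kcomp_bilin E X E; have [al _] := kact_bilin.
have rhoE p : kact (kcomp rho p.1) p.2 = \sum_S
    ((rho : {ffun corr E X -> k^o}) S : k) *: kact (kcomp (fbase k S) p.1) p.2.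
  by rewrite [in LHS](freemod_span rho) (linear_comb (cl _)) (linear_comb (al _)).
rewrite (eq_bigr _ (fun p _ => rhoE p)).
rewrite exchange_big big1 // => S _.
rewrite -scaler_sumr -Jsum -ts; apply/eqP; rewrite scaler_eq0; apply/orP; right.
by move/subv_bigcapP: tJ => /(_ S isT); rewrite -memvE memv_ker.
Qed.

End Functors.
End Correspondences.

(* Products in [{perm E}] are read from left to right: [(s * t) x = t (s x)].
   Hence the permutation "beta alpha" of the usual notation is
   [alpha * beta]; and a representation by matrices acting on the right of row
   vectors, [v |-> v *m rG s], is a left action for the usual composition. *)
Section Automorphisms.
Variables (E : finType) (R : rel E).

Definition autrel_set : {set {perm E}} :=
  [set s : {perm E} | [forall x, forall y, R (s x) (s y) == R x y]].

Lemma autrelP (s : {perm E}) :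
  reflect (forall x y, R (s x) (s y) = R x y) (s \in autrel_set).
Proof.
rewrite inE; apply: (iffP forallP) => h x; last by apply/forallP=> y; apply/eqP.
by move=> y; apply/eqP; move/forallP: (h x).
Qed.

Lemma autrel_group_set : group_set autrel_set.
Proof.
apply/group_setP; split=> [|s t /autrelP sR /autrelP tR].
  by apply/autrelP=> x y; rewrite !perm1.
by apply/autrelP=> x y; rewrite !permM tR sR.
Qed.

Definition autrel : {group {perm E}} := Group autrel_group_set.

Definition oprel : rel E := fun x y => R y x.

End Automorphisms.

Lemma autrel_op (E : finType) (R : rel E) : autrel R :==: autrel (oprel R).
Proof.
have eqR : autrel_set R = autrel_set (oprel R).
  by apply/setP=> s; apply/autrelP/autrelP=> h x y; have := h y x.
by apply/eqP; exact: eqR.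
Qed.

Section Fundamental.
Variables (k : fieldType) (E : finType) (R : rel E).

Definition conjrel (s : {perm E}) : corr E E :=
  [set (s p.1, s p.2) | p : E * E & R p.1 p.2].

Definition fundmod : vectType k := freemod k {perm E}.

Definition fund_perm (Q : corr E E) (s b : {perm E}) : bool :=
  (diag E \subset corr_comp (diag_perm b^-1%g) Q) &&
  (corr_comp (diag_perm b^-1%g) Q \subset conjrel s).

Definition fund_act (Q : corr E E) : 'End(fundmod) :=
  flin (fun s => if [pick b | fund_perm Q s b] is Some b
                 then fbase k (s * b)%g else 0).

Definition fund_ract (t : {perm E}) : 'End(fundmod) :=
  flin (fun s => fbase k (t * s)%g).

Lemma fund_act_ract Q t x :
  t \in autrel R -> fund_act Q (fund_ract t x) = fund_ract t (fund_act Q x).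
Proof.
move=> /autrelP tR; rewrite [x]freemod_span !linear_sum /=.
apply: eq_bigr => s _; rewrite !linearZ /=; congr (_ *: _).
rewrite /fund_act /fund_ract !flin_base.
have -> : [pick b | fund_perm Q (t * s)%g b] = [pick b | fund_perm Q s b].
  suff eqR : conjrel (t * s)%g = conjrel s.
    by apply: eq_pick => b; rewrite /= /fund_perm eqR.
  apply/setP=> p; apply/imsetP/imsetP => -[[x1 y1]]; rewrite inE /= => Rxy ->.
    by exists (t x1, t y1); rewrite ?inE /= ?tR // !permM.
  exists (t^-1%g x1, t^-1%g y1); rewrite ?inE /= ?permM ?permKV //.
  by rewrite -tR !permKV.
by case: pickP => [b _|_]; rewrite ?linear0 // flin_base mulgA.
Qed.

Variables (n : nat) (rG : mx_representation k (autrel R) n).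

Definition rep_act (t : {perm E}) : 'End('rV[k]_n) := linfun (mulmxr (rG t)).

(* The left kC(E,E)-module obtained by tensoring the fundamental module with V
   over kAut(E,R). *)
Definition fundV : vectType k := btensor (mem (autrel R)) fund_ract rep_act.

Definition fundV_act (Q : corr E E) : 'End(fundV) :=
  quot_map _ _ (tens_map (fund_act Q) \1%VF).

Lemma fundV_actE Q x v :
  fundV_act Q (btens (mem (autrel R)) fund_ract rep_act x v) =
  btens (mem (autrel R)) fund_ract rep_act (fund_act Q x) v.
Proof.
rewrite /fundV_act /btens quot_mapE ?tens_mapE ?lfun_simp // => t.
move/memv_sumP=> [f fP ->]; rewrite linear_sum; apply: memv_suml => d dA.
have /memv_imgP[u _ ->] := fP d dA.
apply: (subvP (sumv_sup d dA (subvv _))).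
pose g := (tens_map (fund_ract d) \1 - tens_map \1 (rep_act d))%VF.
suff eqg : tens_map (fund_act Q) \1 (g u) = g (tens_map (fund_act Q) \1 u).
  by rewrite /= eqg; exact: memv_img (memvf _).
rewrite /g -!comp_lfunE; congr (fun_of_lfun _ u); apply: tens_ext => y w.
rewrite !(comp_lfunE, tens_mapE, add_lfunE, opp_lfunE, linearB, id_lfunE) /=.
by rewrite !(tens_mapE, id_lfunE) fund_act_ract.
Qed.

(* The value at X of the functor S_{E,R,V}. *)
Definition Sfun (X : finType) : vectType k := LJfun fundV_act X.

End Fundamental.

Section StableValue.
Variables (d : Order.disp_t) (T : finPOrderType d) (f : T -> T).

(* For the maps f used below (f t <= t for all t, or t <= f t for all t) the
   iterates are stationary after at most #|T| steps, see [stable_deflate] and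
   [stable_inflate]. *)
Definition stable (t : T) : T := iter #|T| f t.

Local Open Scope order_scope.

Lemma stable_deflate : (forall t, f t <= t) -> forall t, f (stable t) = stable t.
Proof.
move=> fle t; apply/eqP; apply: contraT => nst.
suff /(_ #|T|) [st|] : forall n, f (iter n f t) = iter n f t \/
    (#|[set x | (x <= iter n f t)%O]| + n <= #|T|)%N.
- by rewrite /stable st eqxx in nst.
- rewrite leqNgt -[X in (X < _)%N]add0n ltn_add2r card_gt0 => /negP[].
  by apply/set0Pn; exists (iter #|T| f t); rewrite inE.
elim=> [|n [st|IH]]; first by right; rewrite addn0 max_card.
  by left; rewrite /= !st.
have [st|lt_f] := eqVneq (f (iter n f t)) (iter n f t); first by left; rewrite /= !st.
right; apply: leq_trans IH; rewrite addnS -addSn leq_add2r.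
apply: proper_card; apply/properP; split.
  by apply/subsetP=> x; rewrite !inE => /le_trans; apply; apply: fle.
exists (iter n f t); rewrite !inE //=; apply/negP=> le_f.
by case/eqP: lt_f; apply/le_anti; rewrite fle.
Qed.

Lemma stable_inflate : (forall t, t <= f t) -> forall t, f (stable t) = stable t.
Proof.
move=> fge t; apply/eqP; apply: contraT => nst.
suff /(_ #|T|) [st|] : forall n, f (iter n f t) = iter n f t \/
    (#|[set x | (iter n f t <= x)%O]| + n <= #|T|)%N.
- by rewrite /stable st eqxx in nst.
- rewrite leqNgt -[X in (X < _)%N]add0n ltn_add2r card_gt0 => /negP[].
  by apply/set0Pn; exists (iter #|T| f t); rewrite inE.
elim=> [|n [st|IH]]; first by right; rewrite addn0 max_card.
  by left; rewrite /= !st.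
have [st|lt_f] := eqVneq (f (iter n f t)) (iter n f t); first by left; rewrite /= !st.
right; apply: leq_trans IH; rewrite addnS -addSn leq_add2r.
apply: proper_card; apply/properP; split.
  by apply/subsetP=> x; rewrite !inE; apply: le_trans; apply: fge.
exists (iter n f t); rewrite !inE //=; apply/negP=> le_f.
by case/eqP: lt_f; apply/le_anti; rewrite fge andbT.
Qed.

End StableValue.

Section Lattice.
Variables (d : Order.disp_t) (T : finTBLatticeType d).
Local Open Scope order_scope.

Definition irreducible (e : T) : bool :=
  [forall A : {set T}, (e == \join_(a in A) a) ==> (e \in A)].

Definition rmap (t : T) : T := \join_(s | s < t) s.
Definition rinf (t : T) : T := stable rmap t.

Definition sigma (t : T) : T := \meet_(e | irreducible e && (t < e)) e.
Definition sigmainf (t : T) : T := stable sigma t.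

Lemma rmap_rinf t : rmap (rinf t) = rinf t.
Proof. by apply: stable_deflate => s; apply/joinsP => u /ltW. Qed.

Lemma sigma_sigmainf t : sigma (sigmainf t) = sigmainf t.
Proof. by apply: stable_inflate => s; apply/meetsP => u /andP[_ /ltW]. Qed.

Lemma irreducible_rmap e : irreducible e -> rmap e != e.
Proof.
move=> /forallP/(_ [set s | s < e]) irr; apply/eqP => re.
by move: irr; rewrite inE ltxx implybF => /eqP[]; rewrite -[LHS]re;
  apply: eq_bigl => s; rewrite inE.
Qed.

Section Irr.
Variables (d' : Order.disp_t) (E : finPOrderType d') (i : E -> T).

(* Irr(T) = (E,R), the inclusion of E in T being i. *)
Definition is_Irr : Prop :=
  {mono i : x y / x <= y} /\ (forall t, irreducible t = (t \in codom i)).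

(* The restriction to E of a permutation s of T which preserves i(E); the value
   is irrelevant for other s. *)
Definition restr (s : {perm T}) : {perm E} :=
  insubd (1%g : {perm E})
    [ffun e => odflt e [pick e' | i e' == s (i e)]].

Definition Gset : {set T} :=
  [set i e | e : E] :|: [set t | t == rinf (sigmainf t)].

Lemma Gset_disjoint : is_Irr ->
  [disjoint [set i e | e : E] & [set t | t == rinf (sigmainf t)]].
Proof.
case=> _ iE; apply/pred0P=> t /=; apply/negP=> /andP[/imsetP[e _ te]].
rewrite inE => /eqP tr; have : irreducible t by rewrite iE te codom_f.
by move/irreducible_rmap; rewrite tr rmap_rinf eqxx.
Qed.

End Irr.
End Lattice.

Lemma aut_irreducible (d : Order.disp_t) (T : finTBLatticeType d)
    (s : {perm T}) t :
  s \in autrel (<=%O : rel T) -> irreducible t -> irreducible (s t).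
Proof.
move=> /autrelP sle /forallP irr; apply/forallP=> A; apply/implyP=> /eqP stA.
have := irr (s @^-1: A); rewrite inE => /implyP; apply; apply/eqP.
apply/le_anti/andP; split; last first.
  by apply/joinsP=> a; rewrite inE => aA; rewrite -sle stA; apply: joins_sup.
rewrite -sle stA; apply/joinsP=> a aA; rewrite -(permKV s a) sle.
by apply: joins_sup; rewrite inE permKV.
Qed.

Lemma restrE (d d' : Order.disp_t) (T : finTBLatticeType d)
    (E : finPOrderType d') (i : E -> T) (s : {perm T}) :
  is_Irr i -> s \in autrel (<=%O : rel T) ->
  forall e, i (restr i s e) = s (i e).
Proof.
case=> imono iE sA; have injf : injective i.
  by move=> x y xy; apply/le_anti; rewrite -!imono xy lexx.
pose f := [ffun e => odflt e [pick e' | i e' == s (i e)]].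
have fE e : i (f e) = s (i e).
  rewrite ffunE; case: pickP => [e' /eqP //|no] /=.
  have : irreducible (s (i e)) by rewrite aut_irreducible // iE codom_f.
  by rewrite iE => /codomP[e' e'E]; have := no e'; rewrite e'E eqxx.
have finj : injectiveb f.
  by apply/injectiveP=> x y /(congr1 i); rewrite !fE => /perm_inj/injf.
have rE : val (restr i s) = f by apply: insubdK.
by move=> e; rewrite -fE -rE unlock.
Qed.

(* Main.v *)
Require Import Defs.
From HB Require Import structures.
From mathcomp Require Import all_boot all_order all_algebra all_fingroup.
From mathcomp Require Import mxrepresentation.

(* Idea.  A correspondence phi from E to X matters only through the map
   x |-> \/ phi_x from X to T, so S_{E,R^op,V}(X) is governed by the 0-1 matrix
   with columns f : X -> T and rows rho : X -> subsets of E, whose entry is 1 when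
   every element of rho_x lies above f x and every e in E is some f x with
   e \in rho_x.  The columns f with E <= f(X) <= G form a basis of its column space.
   They span: if t is reducible and the least meet e of irreducibles above t is
   irreducible, the value t can be traded for e while the other values e move up
   to sigma e, until a value r^oo sigma^oo t in G is reached.  They are
   independent: by inclusion-exclusion over the subsets of E the matrix is a sum
   of tensor powers of one-point matrices, which suitable row operations make
   simultaneously triangular.  Finally Aut(E,R) = Aut(T) permutes this basis
   freely, because a column f with E <= f(X) determines the automorphisms fixing
   it, so tensoring with V multiplies the dimension by dim V / |Aut(E,R)|. *)

Set Implicit Arguments.
Unset Strict Implicit.
Unset Printing Implicit Defensive.

Import Order.TTheory GRing.Theory.
Local Open Scope ring_scope.

(** * Reducible elements, meets of irreducibles and bulbs *)

Section LatticeLemmas.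
Variables (d : Order.disp_t) (T : finTBLatticeType d).
Local Open Scope order_scope.
Implicit Types s t u e : T.

Lemma rmap_le t : rmap t <= t.
Proof. by apply/joinsP => u /ltW. Qed.

Lemma rmap_id t : ~~ irreducible t -> rmap t = t.
Proof.
rewrite negb_forall => /existsP[A]; rewrite negb_imply => /andP[/eqP tA tnA].
apply/le_anti; rewrite rmap_le {1}tA /=; apply/joinsP => a aA.
apply: joins_sup; rewrite lt_neqAle; apply/andP; split.
  by apply: contraNneq tnA => <-.
by rewrite tA; apply: joins_sup.
Qed.

(** Either t < s, and t is one of the elements joined in [rmap s], or t = s, and a reducible element
    is the join of the smaller ones. Hence r^oo never drops below a reducible lower bound. *)
Lemma le_rmap s t : ~~ irreducible t -> t <= s -> t <= rmap s.
Proof.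
move=> tI; rewrite le_eqVlt => /predU1P[<-|ts]; first by rewrite rmap_id.
exact: joins_sup.
Qed.

Lemma le_rinf s t : ~~ irreducible t -> t <= s -> t <= rinf s.
Proof.
by move=> tI ts; rewrite /rinf /stable; elim: #|T| => //= n; apply: le_rmap.
Qed.

Lemma rinf_le s : rinf s <= s.
Proof.
rewrite /rinf /stable; elim: #|T| => //= n; exact/le_trans/rmap_le.
Qed.

Lemma rinf_reducible s : ~~ irreducible (rinf s).
Proof. by apply/negP => /irreducible_rmap; rewrite rmap_rinf eqxx. Qed.

Lemma sigma_ge t : t <= sigma t.
Proof. by apply/meetsP => e /andP[_ /ltW]. Qed.

Lemma sigma_le t e : irreducible e -> t < e -> sigma t <= e.
Proof. by move=> eI te; apply: meets_inf; rewrite eI. Qed.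

Lemma sigma_mono s t : s <= t -> sigma s <= sigma t.
Proof.
by move=> st; apply/meetsP => e /andP[eI te]; apply: sigma_le (le_lt_trans st te).
Qed.

Lemma iter_sigma_mono n s t : s <= t -> iter n (@sigma d T) s <= iter n (@sigma d T) t.
Proof. by move=> st; elim: n => //= n /sigma_mono. Qed.

Lemma iter_sigma_fix n s : sigma s = s -> iter n (@sigma d T) s = s.
Proof. by move=> ss; elim: n => //= n ->. Qed.

Lemma iter_sigma_ge n t : t <= iter n (@sigma d T) t.
Proof. by elim: n => //= n /le_trans; apply; apply: sigma_ge. Qed.

Lemma sigmainf_fix s : sigma s = s -> sigmainf s = s.
Proof. exact: iter_sigma_fix. Qed.

Lemma sigmainf_iter n t : sigmainf (iter n (@sigma d T) t) = sigmainf t.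
Proof.
rewrite /sigmainf /stable -iterD addnC iterD.
exact: (iter_sigma_fix n (sigma_sigmainf t)).
Qed.

Lemma iter_sigma_le n t : iter n (@sigma d T) t <= sigmainf t.
Proof. by rewrite -(sigmainf_iter n); exact: iter_sigma_ge. Qed.

(** A value t of a column bounds rho x only through the irreducibles above t, that is through this
    closure; it is t for t irreducible and sigma t otherwise. *)
Definition irrclos t : T := \meet_(e | irreducible e && (t <= e)) e.

Lemma irrclos_ge t : t <= irrclos t.
Proof. by apply/meetsP => e /andP[]. Qed.

Lemma irrclos_le t e : irreducible e -> t <= e -> irrclos t <= e.
Proof. by move=> eI te; apply: meets_inf; rewrite eI. Qed.

Lemma irrclos_leE t e : irreducible e -> (irrclos t <= e) = (t <= e).
Proof.
move=> eI; apply/idP/idP; last exact: irrclos_le.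
exact/le_trans/irrclos_ge.
Qed.

Lemma irrclos_id t : irreducible t -> irrclos t = t.
Proof. by move=> tI; apply/le_anti; rewrite irrclos_ge irrclos_le. Qed.

Lemma irrclos_reducible t : ~~ irreducible t -> irrclos t = sigma t.
Proof.
move=> tI; apply: eq_bigl => e; rewrite lt_neqAle.
by case eI: (irreducible e) => //=; case: eqP => // te; rewrite te eI in tI.
Qed.

Lemma irrclos_idem t : irrclos (irrclos t) = irrclos t.
Proof.
by apply: eq_bigl => e; case eI: (irreducible e); rewrite //= irrclos_leE.
Qed.

Lemma irrclos_sigma t : irrclos (sigma t) = sigma t.
Proof.
apply/le_anti; rewrite irrclos_ge andbT; apply/meetsP => e /andP[eI te].
by apply: irrclos_le => //; apply: sigma_le.
Qed.

Lemma sigma_le_closed t u : irrclos u = u -> t < u -> sigma t <= u.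
Proof.
move=> <- tu; apply/meetsP => e /andP[eI ue]; apply: sigma_le => //.
by rewrite (lt_le_trans tu) // irrclos_le.
Qed.

(** A closed u above an iterate of [sigma] and different from it lies above the next one. If u were
    never met, it would lie above [sigmainf t], which is itself an iterate. *)
Lemma sigma_orbit t u : irrclos u = u -> t <= u -> u <= sigmainf t ->
  exists n, iter n (@sigma d T) t = u.
Proof.
move=> uC tu uS; have [/existsP[n /eqP]|no] :=
  boolP [exists n : 'I_#|T|.+1, iter n (@sigma d T) t == u]; first by exists n.
have le_u : forall n, (n <= #|T|)%N -> iter n (@sigma d T) t <= u.
  elim=> //= n IH nT; apply: sigma_le_closed => //.
  rewrite lt_neqAle IH 1?ltnW // andbT.
  move: no; rewrite negb_exists => /forallP/(_ (Ordinal (leqW nT))) //=.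
by exists #|T|; apply/le_anti; rewrite le_u.
Qed.

(** The bulbs are the elements of G outside E. *)
Definition bulb t := t == rinf (sigmainf t).

Lemma bulbE t : bulb t -> rinf (sigmainf t) = t.
Proof. by move/eqP. Qed.

Lemma bulb_reducible t : bulb t -> ~~ irreducible t.
Proof. by move/eqP => ->; apply: rinf_reducible. Qed.

(** The bulb is g = r^oo sigma^oo t. From t <= g <= sigma^oo t it has the same sigma^oo as t, and
    the closed element sigma g lies between sigma t and sigma^oo t. *)
Lemma bulb_sigma_orbit t : ~~ irreducible t ->
  exists g, bulb g /\ exists n, iter n (@sigma d T) (irrclos t) = irrclos g.
Proof.
move=> tI; set s := sigmainf t; set g := rinf s.
have tg : t <= g by apply: le_rinf => //; exact: (iter_sigma_le 0).
have gs : sigmainf g = s.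
  apply/le_anti; rewrite (iter_sigma_mono _ tg) andbT.
  rewrite -[leRHS](sigmainf_fix (sigma_sigmainf t)).
  exact: iter_sigma_mono (rinf_le s).
exists g; split; first by rewrite /bulb gs.
rewrite !irrclos_reducible ?rinf_reducible //.
apply: sigma_orbit (irrclos_sigma g) (sigma_mono tg) _.
by rewrite (sigmainf_iter 1) -/s -gs (iter_sigma_le 1).
Qed.

Lemma join_irreducible t : t = \join_(e | irreducible e && (e <= t)) e.
Proof.
suff: forall n t, (#|[set x : T | (x <= t)%O]| <= n)%N ->
  t = \join_(e | irreducible e && (e <= t)) e by move/(_ _ t (leqnn _)).
elim=> [{}t|n IH {}t tn].
  by rewrite leqn0 cards_eq0 => /eqP/setP/(_ t); rewrite !inE lexx.
apply/le_anti/andP; split; last by apply/joinsP => e /andP[].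
have [tI|tI] := boolP (irreducible t); first by apply: joins_sup; rewrite tI lexx.
rewrite -[leLHS](rmap_id tI); apply/joinsP => s st.
rewrite [leLHS]IH; last first.
  rewrite -ltnS; apply: leq_trans tn; apply: proper_card; apply/properP; split.
    by apply/subsetP => x; rewrite !inE => /le_trans; apply; apply: ltW.
  by exists t; rewrite !inE ?lexx //; apply/negP => /(lt_le_trans st); rewrite ltxx.
apply/joinsP => e /andP[eI es]; apply: joins_sup; rewrite eI.
exact: le_trans es (ltW st).
Qed.

End LatticeLemmas.

(** * A depth on G for which the one-point matrices become triangular *)

Section Depth.
Variables (d : Order.disp_t) (T : finTBLatticeType d).
Local Open Scope order_scope.
Implicit Types s t g : T.

(* For g irreducible this says that g lies in the sigma-orbit of a bulb. *)
Definition onpath g := [exists t, bulb t && (t <= g <= sigmainf t)].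

(** An upper bound for the values t seen by the row operation attached to g, see [rowval_neq0]. *)
Definition kappa g := if onpath g then sigmainf g else g.

Lemma bulb_onpath g : bulb g -> onpath g.
Proof.
move=> gB; apply/existsP; exists g; rewrite gB lexx; exact: (iter_sigma_le 0).
Qed.

(** An irreducible g is closed, hence an iterate of [sigma] on the bulb below it; both then have the
    same sigma^oo, from which the bulb is recovered by r^oo. *)
Lemma onpath_orbit g : bulb g || irreducible g -> onpath g ->
  bulb (rinf (sigmainf g)) /\ exists n, g = iter n (@sigma _ T) (rinf (sigmainf g)).
Proof.
move=> gG /existsP[t /and3P[tB tg gt]]; case/orP: gG => gG.
  by rewrite bulbE //; split=> //; exists 0.
have [n <-] := sigma_orbit (irrclos_id gG) tg gt.
by rewrite sigmainf_iter bulbE //; split=> //; exists n.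
Qed.

Lemma onpath_sigmainf g n : bulb g || irreducible g -> onpath g ->
  onpath (iter n (@sigma _ T) g).
Proof.
move=> gG /(onpath_orbit gG)[tB [m gt]]; set t := rinf _ in tB gt.
apply/existsP; exists t; rewrite tB gt -iterD iter_sigma_ge; exact: iter_sigma_le.
Qed.

(** In the case of g off the paths and g' on one, the iterates of [sigma] on g' stay on a path, so
    they never equal the irreducible g and cannot pass it. *)
Lemma kappa_homo g g' : bulb g || irreducible g -> bulb g' || irreducible g' ->
  g' <= kappa g -> kappa g' <= kappa g.
Proof.
move=> gG g'G le_g'; rewrite {1}/kappa; case: ifP => // g'P.
move: le_g'; rewrite /kappa; case: ifPn => gP g'g.
  rewrite -[leRHS](sigmainf_fix (sigma_sigmainf g)); exact: iter_sigma_mono.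
have gI : irreducible g by case/orP: gG => // /bulb_onpath; rewrite (negbTE gP).
rewrite /sigmainf /stable; elim: #|T| => // n IH; apply: sigma_le => //.
rewrite lt_neqAle IH andbT; apply: contraNneq gP => <-.
exact: onpath_sigmainf.
Qed.

(** Two elements on paths with the same [kappa] lie on the orbit of one bulb, so they are
    comparable. If only one is on a path the values differ, because [kappa] keeps an element on a
    path and fixes an element off the paths. *)
Lemma kappa_inj g g' : bulb g || irreducible g -> bulb g' || irreducible g' ->
  (onpath g -> ~~ bulb g -> ~~ (g' < g)) -> kappa g' = kappa g -> g <= g'.
Proof.
move=> gG g'G nlt; rewrite /kappa; case: ifPn => g'P; case: ifPn => gP kE.
- have [g'B [n' g'E]] := onpath_orbit g'G g'P.
  have [gB [n gE]] := onpath_orbit gG gP.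
  rewrite kE in g'E; have [/bulbE gr|gN] := boolP (bulb g).
    by rewrite g'E gr iter_sigma_ge.
  have [le|/ltnW le] := leqP n n'.
    by rewrite g'E -(subnK le) iterD -gE iter_sigma_ge.
  have g'g : g' <= g by rewrite [leRHS]gE -(subnK le) iterD -g'E iter_sigma_ge.
  by move: (nlt gP gN); rewrite lt_neqAle g'g andbT negbK => /eqP->.
- have := onpath_sigmainf #|T| g'G g'P.
  by rewrite -/(stable _ _) -/(sigmainf _) kE (negbTE gP).
- have := onpath_sigmainf #|T| gG gP.
  by rewrite -/(stable _ _) -/(sigmainf _) -kE (negbTE g'P).
- by rewrite kE.
Qed.

(** A lexicographic order: the lower set of [kappa g] first, then the upper set of g, whose size is
    at most [#|T|] and so below the weight [#|T|.+1]. *)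
Definition depth g : nat :=
  (#|[set x : T | (x <= kappa g)%O]| * #|T|.+1 + #|[set x : T | (g <= x)%O]|)%N.

Lemma depth_lt g g' : bulb g || irreducible g -> bulb g' || irreducible g' ->
  g' <= kappa g -> (onpath g -> ~~ bulb g -> ~~ (g' < g)) -> g' != g ->
  (depth g' < depth g)%N.
Proof.
move=> gG g'G le_g' nlt g'g; have := kappa_homo gG g'G le_g'.
rewrite le_eqVlt => /predU1P[kE|klt].
  rewrite /depth kE ltn_add2l; apply: proper_card; apply/properP; split.
    apply/subsetP => x; rewrite !inE; exact/le_trans/kappa_inj.
  exists g; rewrite !inE ?lexx //; apply: contra g'g => g'g.
  by apply/eqP/le_anti; rewrite g'g kappa_inj.
rewrite /depth; set a := #|[set x : T | (x <= kappa g')%O]|; set b := #|_ |.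
have ab : (a < #|[set x : T | (x <= kappa g)%O]|)%N.
  apply: proper_card; apply/properP; split.
    by apply/subsetP => x; rewrite !inE => /le_trans; apply; apply: ltW.
  by exists (kappa g); rewrite !inE ?lexx //; apply/negP => /(lt_le_trans klt); rewrite ltxx.
apply: leq_trans (leq_addr _ _).
apply: (@leq_trans (a.+1 * #|T|.+1)); last by rewrite leq_mul2r ab orbT.
by rewrite mulSn addnC -addSn leq_add2r ltnS max_card.
Qed.

End Depth.

(** * The column space *)

Section Columns.
Variables (dE dT : Order.disp_t) (E : finPOrderType dE) (T : finTBLatticeType dT).
Variables (i : E -> T) (X : finType) (irrT : is_Irr i).
Implicit Types (rho : {ffun X -> {set E}}) (phi : {ffun X -> T}).
Implicit Types (f : {ffun X -> E + T}).

Lemma irr_mono : {mono i : x y / (x <= y)%O}. Proof. by case: irrT. Qed.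

Lemma irr_inj : injective i.
Proof. by move=> x y xy; apply/le_anti; rewrite -!irr_mono xy lexx. Qed.

Lemma irr_i e : irreducible (i e).
Proof. by case: irrT => _ ->; apply: codom_f. Qed.

Lemma irr_codom t : irreducible t -> exists e, t = i e.
Proof. by case: irrT => _ -> /codomP. Qed.

Lemma le_irrclos t e : (irrclos t <= i e)%O = (t <= i e)%O.
Proof. exact: irrclos_leE (irr_i e). Qed.

Definition colval (a : E + T) : T := match a with inl e => i e | inr t => t end.

(* The entry (rho, f) of the matrix of the pairing, for columns f in which only
   the values inl e can realise e; the value inr (i e) just bounds rho x. *)
Definition vcol f rho : bool :=
  [forall x, forall e in rho x, (colval (f x) <= i e)%O] &&
  [forall e, exists x, (f x == inl e) && (e \in rho x)].

Definition col phi rho : bool :=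
  [forall x, forall e in rho x, (phi x <= i e)%O] &&
  [forall e, exists x, (phi x == i e) && (e \in rho x)].

Lemma vcolP f rho :
  reflect ((forall x e, e \in rho x -> (colval (f x) <= i e)%O) /\
           (forall e, exists x, f x = inl e /\ e \in rho x)) (vcol f rho).
Proof.
apply: (iffP andP) => -[h1 h2]; split.
- by move=> x e ex; move/forallP/(_ x)/forall_inP: h1; apply.
- by move=> e; move/forallP/(_ e)/existsP: h2 => [x /andP[/eqP fx ex]]; exists x.
- by apply/forallP => x; apply/forall_inP => e; apply: h1.
- apply/forallP => e; apply/existsP; have [x [fx ex]] := h2 e.
  by exists x; rewrite fx eqxx.
Qed.

(** A value [inr t] only bounds rho x, through the closure of t, so any reducible value with the
    same closure can replace it. *)
Lemma vcol_col f phi rho :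
  (forall x, if f x is inr t then irrclos t = irrclos (phi x) /\ ~~ irreducible (phi x)
             else colval (f x) = phi x) ->
  vcol f rho = col phi rho.
Proof.
move=> fphi; congr andb; apply: eq_forallb; [move=> x|move=> e].
  apply: eq_forallb => e; congr (_ ==> _); move: (fphi x).
  by case: (f x) => [e'|t] /= => [->|[tx _]] //; rewrite -le_irrclos tx le_irrclos.
apply: eq_existsb => x; congr (_ && _); move: (fphi x).
case: (f x) => [e'|t] /= => [<-|[_ xI]]; first by rewrite (inj_eq irr_inj).
by apply/esym/negbTE; apply: contraNneq xI => ->; apply: irr_i.
Qed.

(* If t has closure e and e is not the meet of the irreducibles above it, then
   at each x with e <= rho x either e \in rho x or sigma e <= rho x: this trades
   the value t for e at one point, up to moving the other values e to sigma e. *)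
Lemma vcol_exchange f x t e rho :
    f x = inr t -> irrclos t = i e -> sigma (i e) != i e ->
  let f1 := [ffun y => if y == x then inl e else f y] in
  let f2 := [ffun y => if y == x then inl e
                       else if f y == inl e then inr (sigma (i e)) else f y] in
  (vcol f1 rho = vcol f rho || vcol f2 rho) /\ ~~ (vcol f rho && vcol f2 rho).
Proof.
move=> fx te sNe f1 f2.
have le_t e' : (t <= i e')%O = (i e <= i e')%O by rewrite -te le_irrclos.
have le_s e' : (sigma (i e) <= i e')%O = (i e < i e')%O.
  apply/idP/idP; last by move/sigma_le; apply; apply: irr_i.
  by apply: lt_le_trans; rewrite lt_neqAle eq_sym sNe sigma_ge.
have f12 : vcol f2 rho -> vcol f1 rho.
  move=> /vcolP[a h]; apply/vcolP; split=> [y e' e'y|e'].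
    move: (a y e' e'y); rewrite !ffunE; case: eqP => // _.
    by case: (f y =P inl e) => [->|//] /=; rewrite le_s => /ltW.
  have [y [fy e'y]] := h e'; exists y; split=> //; move: fy; rewrite !ffunE.
  by case: eqP => // _; case: eqP.
have f01 : vcol f rho -> vcol f1 rho.
  move=> /vcolP[a h]; apply/vcolP; split=> [y e' e'y|e'].
    by move: (a y e' e'y); rewrite !ffunE; case: eqP => // ->; rewrite fx /= le_t.
  have [y [fy e'y]] := h e'; exists y; split=> //; rewrite !ffunE.
  by case: eqP fy => // ->; rewrite fx.
split; last first.
  apply/negP => /andP[/vcolP[a h] /vcolP[a2 h2]].
  have [y [fy ey]] := h e; have := a2 _ _ ey; rewrite !ffunE.
  by case: eqP fy => [->|_ ->]; rewrite ?fx // eqxx /= le_s ltxx.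
apply/idP/orP => [/vcolP[a h]|[]//].
have nx e' y : f1 y = inl e' -> e' != e -> y != x /\ f y = inl e'.
  by rewrite ffunE; case: eqP => // _ [->]; rewrite eqxx.
(* The alternative is whether e is realised where f itself has the value [inl e], necessarily away
   from x. If it is not, each such value can be raised to sigma e. *)
have [/existsP[y /andP[/eqP fy ey]]|no] :=
  boolP [exists y, (f y == inl e) && (e \in rho y)]; [left|right].
  apply/vcolP; split=> [z e' e'z|e'].
    by move: (a z e' e'z); rewrite ffunE; case: eqP => // ->; rewrite fx /= le_t.
  have [->|e'e] := eqVneq e' e; first by exists y.
  by have [z [fz e'z]] := h e'; exists z; have [] := nx _ _ fz e'e.
apply/vcolP; split=> [z e' e'z|e'].
  move: (a z e' e'z); rewrite !ffunE; case: eqP => // _.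
  case: (f z =P inl e) => [fz|//]; rewrite fz /= le_s lt_neqAle => ->.
  rewrite andbT (inj_eq irr_inj); apply: contraNneq no => ee.
  by apply/existsP; exists z; rewrite fz eqxx ee.
have [->|e'e] := eqVneq e' e.
  have [z [fz ez]] := h e; exists z; split=> //; move: fz; rewrite !ffunE.
  case: eqP => // _ fz; case/negP: no; apply/existsP; exists z.
  by rewrite fz eqxx.
have [z [fz e'z]] := h e'; exists z; split=> //; have [zx fz'] := nx _ _ fz e'e.
rewrite ffunE (negbTE zx) fz'; case: eqP => // -[ee].
by rewrite ee eqxx in e'e.
Qed.

(** * Spanning: reduction of every column to those of [colbasis] *)

Definition colbasis : {set {ffun X -> T}} :=
  [set phi : {ffun X -> T} | [forall e, exists x, phi x == i e] &&
                             [forall x, phi x \in Gset i]].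

Variable k : fieldType.

Definition spanned (p : {ffun X -> {set E}} -> bool) : Prop :=
  exists c : {ffun X -> T} -> k,
  forall rho, (p rho)%:R = \sum_(b in colbasis) c b * (col b rho)%:R.

(** If some e is not a value of phi, then e is never realised and the column vanishes. *)
Lemma spanned_col phi : (forall x, phi x \in Gset i) -> spanned (col phi).
Proof.
move=> phiG; have [phiE|phiE] := boolP [forall e, exists x, phi x == i e].
  have phiB : phi \in colbasis by rewrite inE phiE; apply/forallP.
  exists (fun b => (b == phi)%:R) => rho; rewrite (bigD1 phi) //= eqxx mul1r.
  by rewrite big1 ?addr0 // => b /andP[_ /negbTE->]; rewrite mul0r.
exists (fun=> 0) => rho; rewrite big1 => [|b _]; last by rewrite mul0r.
suff /negbTE-> : ~~ col phi rho by [].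
apply: contra phiE => /andP[_ /forallP h]; apply/forallP => e.
by apply/existsP; move/existsP: (h e) => [x /andP[? _]]; exists x.
Qed.

Lemma spannedB (p q r : {ffun X -> {set E}} -> bool) :
  (forall rho, (q rho = p rho || r rho) /\ ~~ (p rho && r rho)) ->
  spanned q -> spanned r -> spanned p.
Proof.
move=> pqr [a ha] [b hb]; exists (fun g => a g - b g) => rho.
transitivity ((q rho)%:R - (r rho)%:R : k).
  have [-> ] := pqr rho; case: (p rho); case: (r rho) => //= _.
    by rewrite subr0.
  by rewrite subrr.
  by rewrite subrr.
rewrite ha hb -sumrB; apply: eq_bigr => g _; by rewrite mulrBl.
Qed.

Definition reaches_bulb t : Prop :=
  exists g, bulb g /\ exists n, iter n (@sigma _ T) (irrclos t) = irrclos g.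

(** [vcol_exchange] is repeated until each value [inr t] has the closure of a bulb; the bulb is then
    put in its place. *)
Lemma spanned_vcol f :
  (forall x t, f x = inr t -> reaches_bulb t) -> spanned (vcol f).
Proof.
pose h (t : T) := #|[set y : T | (t <= y)%O]|.
(* With this doubling both moves of the exchange lower the weight: [inr t] to [inl e] with t <= e,
   and [inl e] to [inr (sigma e)], where the upper set strictly shrinks. *)
pose w (a : E + T) := match a with inl e => (h (i e)).*2 | inr t => (h t).*2.+1 end.
have [N] := ubnP (\sum_x w (f x))%N; elim: N f => // N IH f; rewrite ltnS => fN fR.
have hle (s t : T) : (s <= t)%O -> (h t <= h s)%N.
  move=> st; apply/subset_leq_card/subsetP => y; rewrite !inE; exact: le_trans.
have hlt (s t : T) : (s < t)%O -> (h t < h s)%N.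
  move=> st; apply/proper_card/properP; split.
    by apply/subsetP => y; rewrite !inE; apply/le_trans/ltW.
  by exists s; rewrite !inE ?lexx //; apply/negP => /(lt_le_trans st); rewrite ltxx.
pose good (t : T) := [pick g : T | bulb g && (irrclos t == irrclos g)].
have [allgood|] := boolP [forall x, if f x is inr t then good t else true].
  pose phi := [ffun x => match f x with inl e => i e | inr t => odflt t (good t) end].
  have fphi x : if f x is inr t then [/\ irrclos t = irrclos (phi x),
      ~~ irreducible (phi x) & bulb (phi x)] else colval (f x) = phi x.
    rewrite ffunE; move/forallP: allgood => /(_ x); case: (f x) => //= t.
    by rewrite /good; case: pickP => //= g /andP[/[dup] /bulb_reducible gI gB /eqP].
  have [] : spanned (col phi).
    apply: spanned_col => x; rewrite !inE; move: (fphi x).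
    case: (f x) => [e <-|t [_ _ xB]]; first by rewrite /= imset_f.
    by apply/orP; right.
  move=> c hc; exists c => rho; rewrite -hc; congr (_%:R); congr nat_of_bool.
  by apply: vcol_col => x; move: (fphi x); case: (f x) => // t [].
rewrite negb_forall => /existsP[x]; case fx: (f x) => [//|t] tN.
have nogood g : bulb g -> irrclos t <> irrclos g.
  move=> gB tg; move: tN; rewrite /good; case: pickP => // /(_ g).
  by rewrite gB tg eqxx.
have [g [gB [[|n] ng]]] := fR x t fx; first by case: (nogood _ gB).
have sN : sigma (irrclos t) != irrclos t.
  apply/eqP => st; case: (nogood _ gB); rewrite -ng.
  by rewrite (iter_sigma_fix _ st).
(* A reducible closed element is fixed by [sigma], so the closure of t must be irreducible. *)
have [|e te] := @irr_codom (irrclos t).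
  apply: contraNT sN => tI; by rewrite -irrclos_reducible // irrclos_idem.
rewrite te in sN; have := fun rho => vcol_exchange rho fx te sN.
set f1 := [ffun y => _]; set f2 := [ffun y => _] => ex.
have tle : (t <= i e)%O by rewrite -te irrclos_ge.
have wx : (w (inl e) < w (f x))%N by rewrite fx /= ltnS leq_double hle.
apply: (spannedB ex); apply: IH.
- apply: leq_trans fN; rewrite (bigD1 x) //= [in leqRHS](bigD1 x) //= ffunE eqxx.
  rewrite -addSn; apply: leq_add => //; apply: leq_sum => y /negbTE yx.
  by rewrite ffunE yx.
- by move=> y s; rewrite ffunE; case: eqP => // _; apply: fR.
- apply: leq_trans fN; rewrite (bigD1 x) //= [in leqRHS](bigD1 x) //= ffunE eqxx.
  rewrite -addSn; apply: leq_add => //; apply: leq_sum => y /negbTE yx.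
  rewrite ffunE yx; case: (f y =P inl e) => [->|//] /=.
  rewrite ltn_double hlt // lt_neqAle eq_sym sN; exact: sigma_ge.
- move=> y s; rewrite ffunE; case: eqP => // _; case: (f y =P inl e) => [_ [<-]|_].
    (* The new value sigma e is one step further along the orbit leading to the closure of the same
       bulb. *)
    by exists g; split=> //; exists n; rewrite irrclos_sigma -te -iterSr.
  exact: fR.
Qed.

Lemma spanned_all phi : spanned (col phi).
Proof.
pose f := [ffun x => if [pick e | i e == phi x] is Some e then inl e else inr (phi x)].
have fphi x : if f x is inr t then t = phi x /\ ~~ irreducible (phi x)
              else colval (f x) = phi x.
  rewrite ffunE; case: pickP => [e /eqP//|no]; split=> //.
  by apply/negP => /irr_codom[e xe]; have := no e; rewrite xe eqxx.
have [|c hc] := @spanned_vcol f.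
  move=> x t fx; have := fphi x; rewrite fx => -[-> xI].
  exact: bulb_sigma_orbit xI.
exists c => rho; rewrite -hc; congr (nat_of_bool _)%:R; apply/esym/vcol_col => x.
by have := fphi x; case: (f x) => // t [->].
Qed.

(** * Linear independence: row operations and a triangular matrix *)

Lemma in_Gset g : g \in Gset i -> bulb g || irreducible g.
Proof.
by rewrite !inE => /orP[/imsetP[e _ ->]|gB]; apply/orP; [right; apply: irr_i|left].
Qed.

Lemma prod_natb (I : finType) (p : pred I) :
  \prod_x (p x)%:R = [forall x, p x]%:R :> k.
Proof.
have [/forallP h|] := boolP [forall x, p x].
  by rewrite big1 // => x _; rewrite h.
by rewrite negb_forall => /existsP[x /negbTE px]; rewrite (bigD1 x) //= px mul0r.
Qed.

Lemma natb_neq0 (b : bool) : (b%:R != 0 :> k) = b.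
Proof. by case: b; rewrite ?oner_eq0 ?eqxx. Qed.

(** The one-point factor in which only the elements e with [F e] may be realised. *)
Definition ecol (F : {ffun E -> bool}) (u : {set E}) (t : T) : bool :=
  [forall e in u, (t <= i e)%O && ((t == i e) ==> F e)].

(** Each e contributes 1 ([F e] true) minus the indicator that e is not realised ([F e] false). Once
    F is fixed, the conditions concern each x separately. *)
Lemma col_incl_excl phi rho : (col phi rho)%:R =
  \sum_(F : {ffun E -> bool}) (\prod_e (-1) ^+ (~~ F e)) *
     \prod_x (ecol F (rho x) (phi x))%:R :> k.
Proof.
pose a := [forall x, forall e in rho x, (phi x <= i e)%O].
pose H e (b : bool) := [forall x, (e \in rho x) && (phi x == i e) ==> b].
transitivity (\sum_(F : {ffun E -> bool})
    a%:R * \prod_e ((-1) ^+ (~~ F e) * (H e (F e))%:R) : k); last first.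
  apply: eq_bigr => F _; rewrite big_split /= mulrCA; congr (_ * _).
  rewrite !prod_natb -natrM mulnb; congr (nat_of_bool _)%:R.
  apply/andP/forallP => [[/forallP ha /forallP hH] x|h].
    apply/forall_inP => e ex; move/forall_inP: (ha x) => -> //=.
    by move/forallP: (hH e) => /(_ x); rewrite ex.
  split; apply/forallP; [move=> x|move=> e].
    by apply/forall_inP => e ex; move/forall_inP: (h x) => /(_ e ex)/andP[].
  apply/forallP => x; apply/implyP => /andP[ex xe].
  by move/forall_inP: (h x) => /(_ e ex)/andP[_]; rewrite xe.
rewrite -big_distrr /=.
rewrite -(bigA_distr_bigA (fun e (b : bool) => (-1) ^+ (~~ b) * (H e b)%:R)) /=.
rewrite /col -mulnb natrM; congr (_ * _); rewrite -prod_natb; apply: eq_bigr => e _.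
rewrite big_bool /= expr0 expr1 mul1r mulN1r.
have -> : H e true by apply/forallP => x; rewrite implybT.
have -> : H e false = ~~ [exists x, (phi x == i e) && (e \in rho x)].
  by rewrite negb_exists; apply: eq_forallb => x; rewrite implybF andbC.
by case: [exists x, _]; rewrite /= ?subr0 ?subrr.
Qed.

Definition rowset (g : T) : {set E} := [set e | (g < i e)%O].
Definition rowsete (g : T) : {set E} := [set e | (g <= i e)%O].

(* For an irreducible g in the orbit of a bulb t the row [g, .[ does not separate
   g from t, hence the difference of two rows. *)
Definition rowfun (g : T) (u : {set E}) : k :=
  if bulb g then (u == rowset (sigmainf g))%:R
  else (u == rowsete g)%:R - (onpath g && (u == rowset g))%:R.

Definition rowval (F : {ffun E -> bool}) g t : k :=
  \sum_u rowfun g u * (ecol F u t)%:R.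

Lemma sum_delta (u0 : {set E}) (b : bool) (p : {set E} -> k) :
  \sum_u (b && (u == u0))%:R * p u = b%:R * p u0.
Proof.
rewrite (bigD1 u0) //= eqxx andbT big1 ?addr0 // => u /negbTE->.
by rewrite andbF mul0r.
Qed.

Lemma rowvalE F g t : rowval F g t =
  if bulb g then (ecol F (rowset (sigmainf g)) t)%:R
  else (ecol F (rowsete g) t)%:R - (onpath g && ecol F (rowset g) t)%:R.
Proof.
rewrite /rowval /rowfun; case: ifP => _.
  by rewrite (sum_delta _ true) mul1r.
under eq_bigr do rewrite mulrBl; rewrite sumrB (sum_delta _ true) sum_delta.
by rewrite mul1r -natrM mulnb.
Qed.

Lemma ecol_rowset_le F g t : ecol F (rowset g) t -> (t <= sigma g)%O.
Proof.
move=> /forall_inP h; apply/meetsP => _ /andP[/irr_codom[e ->] ge].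
by have := h e; rewrite inE ge => /(_ isT)/andP[].
Qed.

Lemma ecol_rowset F g t : (t <= g)%O -> ecol F (rowset g) t.
Proof.
move=> tg; apply/forall_inP => e; rewrite inE => /(le_lt_trans tg) te.
by rewrite ltW //= lt_eqF.
Qed.

Lemma ecol_rowsete_le F e t : ecol F (rowsete (i e)) t -> (t <= i e)%O.
Proof. by move=> /forall_inP/(_ e); rewrite inE lexx => /(_ isT)/andP[]. Qed.

Lemma ecol_rowsete F g t : (t < g)%O -> ecol F (rowsete g) t.
Proof.
move=> tg; apply/forall_inP => e; rewrite inE => /(lt_le_trans tg) te.
by rewrite ltW //= lt_eqF.
Qed.

Lemma ecol_rowsetee F e : ecol F (rowsete (i e)) (i e) = F e.
Proof.
apply/forall_inP/idP => [/(_ e)|Fe e'].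
  by rewrite inE lexx eqxx => /(_ isT)/andP[].
by rewrite inE => -> /=; apply/implyP => /eqP/irr_inj <-.
Qed.

(** The row of a bulb sees only t <= sigma (sigma^oo g) = [kappa g]. For an irreducible g on a path
    the two rows see only t <= sigma g, and they cancel at t < g, where both entries are 1. Off the
    paths only t <= g is seen. The order obtained is the same for all F. *)
Lemma rowval_neq0 F g t : g \in Gset i -> t \in Gset i -> rowval F g t != 0 ->
  t = g \/ (depth t < depth g)%N.
Proof.
move=> gG tG; have [->|tg] := eqVneq t g; [by left|right].
suff [le_t nlt] : (t <= kappa g)%O /\ (onpath g -> ~~ bulb g -> ~~ (t < g)%O).
  exact: depth_lt (in_Gset gG) (in_Gset tG) le_t nlt tg.
move: H; rewrite rowvalE; case: ifP => gB.
  rewrite natb_neq0 => /ecol_rowset_le; rewrite sigma_sigmainf => le_t.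
  by rewrite /kappa bulb_onpath.
have [e ge] : exists e, g = i e.
  by move: (in_Gset gG); rewrite gB => /irr_codom.
rewrite /kappa; have [gP|gP] := boolP (onpath g) => /= h; split=> //.
- apply: le_trans (iter_sigma_le 1 g) => /=.
  have [/ecol_rowset_le //|nrow] := boolP (ecol F (rowset g) t).
  rewrite (negbTE nrow) subr0 natb_neq0 ge in h.
  by rewrite ge; apply: le_trans (sigma_ge _); apply: ecol_rowsete_le h.
- move=> _ _; apply: contra h => lt_tg.
  by rewrite ecol_rowsete // ecol_rowset ?ltW // subrr.
- by move: h; rewrite subr0 natb_neq0 ge; apply: ecol_rowsete_le.
Qed.

Lemma rowval_bulb F g : bulb g -> rowval F g g = 1.
Proof.
by move=> gB; rewrite rowvalE gB ecol_rowset // (iter_sigma_le 0).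
Qed.

Lemma rowval_irr F e : rowval F (i e) (i e) = (F e)%:R - (onpath (i e))%:R.
Proof.
have /negbTE eN : ~~ bulb (i e) by apply/negP => /bulb_reducible; rewrite irr_i.
by rewrite rowvalE eN ecol_rowsetee ecol_rowset // andbT.
Qed.

Definition phirow phi rho : k := \prod_x rowfun (phi x) (rho x).

Lemma phirow_col phi b : \sum_rho phirow phi rho * (col b rho)%:R =
  \sum_(F : {ffun E -> bool}) (\prod_e (-1) ^+ (~~ F e)) *
     \prod_x rowval F (phi x) (b x).
Proof.
under eq_bigr do rewrite col_incl_excl mulr_sumr.
rewrite exchange_big; apply: eq_bigr => F _ /=.
under eq_bigr do rewrite mulrCA /phirow -big_split /=.
by rewrite -mulr_sumr bigA_distr_bigA.
Qed.

(** Since phi takes every value [i e], each F other than [F0] has a zero factor by [rowval_irr]; the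
    term of [F0] is a product of signs. *)
Lemma phirow_diag phi : phi \in colbasis ->
  \sum_rho phirow phi rho * (col phi rho)%:R != 0.
Proof.
rewrite inE => /andP[/forallP phiE /forallP phiG]; rewrite phirow_col.
pose F0 := [ffun e => ~~ onpath (i e)].
have prod0 F : F != F0 -> \prod_x rowval F (phi x) (phi x) = 0.
  move=> FF0; have [e Fe] : exists e, F e != F0 e.
    apply/existsP; rewrite -negb_forall; apply: contra FF0 => /forallP FF0.
    by apply/eqP/ffunP => e; apply/eqP.
  have /existsP[x /eqP xe] := phiE e; rewrite (bigD1 x) //= xe rowval_irr.
  by move: Fe; rewrite ffunE; case: (F e); case: (onpath _) => //= _; rewrite subrr mul0r.
rewrite (bigD1 F0) //= [X in _ + X]big1 ?addr0 => [|F /prod0->]; last by rewrite mulr0.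
rewrite mulf_neq0 //; apply/prodf_neq0; [move=> e _|move=> x _].
  by rewrite signr_eq0.
have [xB|xB] := boolP (bulb (phi x)).
  by rewrite rowval_bulb ?oner_eq0.
have [e xe] : exists e, phi x = i e.
  by move: (in_Gset (phiG x)); rewrite (negbTE xB) => /irr_codom.
rewrite xe rowval_irr ffunE.
by case: (onpath _); rewrite /= ?sub0r ?subr0 ?oppr_eq0 oner_eq0.
Qed.

Lemma phirow_triangular phi b : phi \in colbasis -> b \in colbasis -> b != phi ->
  \sum_rho phirow phi rho * (col b rho)%:R != 0 ->
  (\sum_x depth (b x) < \sum_x depth (phi x))%N.
Proof.
rewrite !inE => /andP[_ /forallP phiG] /andP[_ /forallP bG] bphi.
rewrite phirow_col => h.
have [F hF] : exists F : {ffun E -> bool}, \prod_x rowval F (phi x) (b x) != 0.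
  apply/existsP; apply: contraNT h; rewrite negb_exists => /forallP h.
  by rewrite big1 // => F _; have := h F; rewrite negbK => /eqP->; rewrite mulr0.
have bd x : b x = phi x \/ (depth (b x) < depth (phi x))%N.
  by move/prodf_neq0: hF => /(_ x isT); apply: rowval_neq0.
have [x bx] : exists x, b x != phi x.
  apply/existsP; rewrite -negb_forall; apply: contra bphi => /forallP h'.
  by apply/eqP/ffunP => x; apply/eqP.
rewrite (bigD1 x) //= [in ltnRHS](bigD1 x) //= -addSn leq_add //.
  by case: (bd x) => // xx; rewrite xx eqxx in bx.
by apply: leq_sum => y _; case: (bd y) => [->|/ltnW].
Qed.

(** Among the phi with nonzero coefficient one of least total depth is chosen. Its row operation
    kills all other terms of the relation and leaves its coefficient times a nonzero diagonal
    entry. *)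
Lemma col_free (c : {ffun X -> T} -> k) :
  (forall rho, \sum_(b in colbasis) c b * (col b rho)%:R = 0) ->
  forall b, b \in colbasis -> c b = 0.
Proof.
move=> c0 b bB; apply/eqP; apply: contraT => cb.
pose P := [pred phi : {ffun X -> T} | (phi \in colbasis) && (c phi != 0)].
have [|phi /andP[phiB cphi] phimin] := @arg_minnP _ b P (fun phi => \sum_x depth (phi x))%N.
  by rewrite inE bB.
have : \sum_rho phirow phi rho * \sum_(b in colbasis) c b * (col b rho)%:R = 0.
  by rewrite big1 // => rho _; rewrite c0 mulr0.
under eq_bigr do rewrite mulr_sumr.
rewrite exchange_big (bigD1 phi) //= [X in _ + X]big1 => [|g].
  under eq_bigr do rewrite mulrCA; rewrite -mulr_sumr addr0 => /eqP.
  by rewrite mulf_eq0 (negbTE cphi) (negbTE (phirow_diag phiB)).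
move=> /andP[gB gphi]; under eq_bigr do rewrite mulrCA; rewrite -mulr_sumr.
have [->|cg] := eqVneq (c g) 0; first by rewrite mul0r.
apply/eqP; rewrite mulf_eq0 (negbTE cg) /=; apply: contraT.
move=> /(phirow_triangular phiB gB gphi); rewrite ltnNge phimin //.
by rewrite inE gB.
Qed.

End Columns.

(** * The functor S and the fundamental module *)

Section ModuleLemmas.
Variable k : fieldType.

Lemma freemod_ext (I : finType) (W : vectType k) (f g : 'Hom(freemod k I, W)) :
  (forall i, f (fbase k i) = g (fbase k i)) -> f = g.
Proof.
move=> fg; apply/lfunP => a; rewrite [a]freemod_span !linear_sum.
by apply: eq_bigr => i _; rewrite !linearZ /= fg.
Qed.

Lemma quot_ext (U W : vectType k) (K : {vspace U}) (f g : 'Hom(quotv K, W)) :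
  (forall u, f (quot_proj K u) = g (quot_proj K u)) -> f = g.
Proof. by move=> fg; apply/lfunP => x; rewrite -[x]quot_reprK fg. Qed.

Lemma quot_liftE (U W : vectType k) (K : {vspace U}) (f : 'Hom(U, W)) u :
  (forall v, v \in K -> f v = 0) -> (f \o quot_repr K)%VF (quot_proj K u) = f u.
Proof.
move=> fK; rewrite comp_lfunE; apply/eqP; rewrite -subr_eq0 -linearB; apply/eqP/fK.
by rewrite -quot_proj_eq0 linearB /= quot_reprK subrr.
Qed.

Lemma btens_ext (I : finType) (D : {pred I}) (U W Z : vectType k)
    (ra : I -> 'End(U)) (la : I -> 'End(W)) (f g : 'Hom(btensor D ra la, Z)) :
  (forall u w, f (btens D ra la u w) = g (btens D ra la u w)) -> f = g.
Proof.
move=> fg; apply: quot_ext => t; rewrite -!comp_lfunE; congr (fun_of_lfun _ t).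
by apply: tens_ext => u w; rewrite comp_lfunE [RHS]comp_lfunE; apply: fg.
Qed.

Lemma bal_rel_ker (I : finType) (D : {pred I}) (U W Z : vectType k)
    (ra : I -> 'End(U)) (la : I -> 'End(W)) (f : 'Hom(tensor U W, Z)) :
  (forall d u w, d \in D -> f (tens (ra d u) w) = f (tens u (la d w))) ->
  forall v, v \in bal_rel D ra la -> f v = 0.
Proof.
move=> fb v /memv_sumP[g gP ->]; rewrite linear_sum big1 // => d dD.
have /memv_imgP[u _ ->] := gP d dD; rewrite /= -comp_lfunE.
rewrite [(f \o _)%VF](_ : _ = 0) ?lfunE //; apply: tens_ext => x w.
rewrite !(comp_lfunE, add_lfunE, opp_lfunE, tens_mapE, id_lfunE, zero_lfunE).
by rewrite linearB /= fb // subrr.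
Qed.

Lemma corr_compP (Z Y X : finType) (S : corr Z Y) (Q : corr Y X) z x :
  reflect (exists y, (z, y) \in S /\ (y, x) \in Q) ((z, x) \in corr_comp S Q).
Proof.
rewrite inE; apply: (iffP existsP) => -[y].
  by case/andP=> zy yx; exists y.
by case=> zy yx; exists y; rewrite zy.
Qed.

Lemma corr_compA (W Z Y X : finType) (P : corr W Z) (S : corr Z Y) (Q : corr Y X) :
  corr_comp P (corr_comp S Q) = corr_comp (corr_comp P S) Q.
Proof.
apply/setP => -[w x]; apply/corr_compP/corr_compP.
  by case=> z [wz /corr_compP[y [zy yx]]]; exists y; split=> //; apply/corr_compP; exists z.
by case=> y [/corr_compP[z [wz zy]] yx]; exists z; split=> //; apply/corr_compP; exists y.
Qed.

Lemma kcomp_base (Z Y X : finType) (S : corr Z Y) (Q : corr Y X) :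
  kcomp (fbase k S) (fbase k Q) = fbase k (corr_comp S Q).
Proof. by rewrite /kcomp !flin_base. Qed.

(** * The action on the fundamental module and the evaluation maps of S *)

Section Poset.
Variables (E : finType) (R : rel E).
Hypotheses (Rrefl : reflexive R) (Ranti : antisymmetric R) (Rtrans : transitive R).
Implicit Types (P Q : corr E E) (s b c : {perm E}).

Lemma fund_permP Q s b :
  reflect ((forall e, (b e, e) \in Q) /\
           (forall x y, (b x, y) \in Q -> R (s^-1%g x) (s^-1%g y)))
          (fund_perm R Q s b).
Proof.
have compE x y : ((x, y) \in corr_comp (diag_perm b^-1%g) Q) = ((b x, y) \in Q).
  apply/corr_compP/idP => [[z [/imsetP[e _ [-> ->]] yQ]]|bxy].
    by rewrite permKV.
  exists (b x); split=> //; apply/imsetP; exists (b x) => //.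
  by rewrite permK.
have conjE x y : ((x, y) \in conjrel R s) = R (s^-1%g x) (s^-1%g y).
  apply/imsetP/idP => [[[x' y']]|Rxy]; first by rewrite inE /= => Rxy [-> ->]; rewrite !permK.
  by exists (s^-1%g x, s^-1%g y); rewrite ?inE //= !permKV.
apply: (iffP andP) => -[h1 h2]; split.
- by move=> e; rewrite -compE (subsetP h1) // imset_f.
- by move=> x y; rewrite -compE -conjE => /(subsetP h2).
- by apply/subsetP => _ /imsetP[e _ ->]; rewrite compE; apply: h1.
- by apply/subsetP => -[x y]; rewrite compE conjE; apply: h2.
Qed.

(** For each e, the images of e and c^-1 (b e) under s^-1 are related by R both ways, so
    antisymmetry identifies them. *)
Lemma fund_perm_uniq Q s b c : fund_perm R Q s b -> fund_perm R Q s c -> b = c.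
Proof.
move=> /fund_permP[b1 b2] /fund_permP[c1 c2]; apply/permP => e.
suff /perm_inj : s^-1%g (c^-1%g (b e)) = s^-1%g e by move=> h; rewrite -{2}h permKV.
apply: Ranti; rewrite c2 ?permKV //=.
by have := b2 e (c^-1%g (b e)); apply; rewrite -{1}[b e](permKV c).
Qed.

Lemma fund_act_base Q s b : fund_perm R Q s b ->
  fund_act k R Q (fbase k s) = fbase k (s * b)%g.
Proof.
move=> bQ; rewrite /fund_act flin_base; case: pickP => [c cQ|/(_ b)].
  by rewrite (fund_perm_uniq cQ bQ).
by rewrite bQ.
Qed.

Lemma fund_act_base0 Q s : (forall b, ~~ fund_perm R Q s b) ->
  fund_act k R Q (fbase k s) = 0.
Proof.
move=> nQ; rewrite /fund_act flin_base; case: pickP => // b bQ.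
by have := nQ b; rewrite bQ.
Qed.

Lemma fund_perm_mul P Q s c b : fund_perm R Q s c -> fund_perm R P (s * c)%g b ->
  fund_perm R (corr_comp P Q) s (c * b)%g.
Proof.
move=> /fund_permP[c1 c2] /fund_permP[b1 b2]; apply/fund_permP; split=> [e|x y].
  by apply/corr_compP; exists (c e); rewrite permM.
rewrite permM => /corr_compP[z [/b2 xz zy]].
move: xz; rewrite invMg !permM permK => /Rtrans; apply.
by apply: c2; rewrite permKV.
Qed.

(* If the permutation a lies in P Q, choosing a midpoint for each pair (a e, e)
   gives, by antisymmetry, a permutation. *)
Lemma fund_perm_factor P Q s a : fund_perm R (corr_comp P Q) s a ->
  exists c, fund_perm R Q s c /\ fund_perm R P (s * c)%g (c^-1 * a)%g.
Proof.
move=> /fund_permP[a1 a2].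
have mid e : exists z, ((a e, z) \in P) && ((z, e) \in Q).
  by have /corr_compP[z [az ze]] := a1 e; exists z; rewrite az.
pose g e := xchoose (mid e).
have gP e : (a e, g e) \in P by have /andP[] := xchooseP (mid e).
have gQ e : (g e, e) \in Q by have /andP[] := xchooseP (mid e).
have gR e y : (g e, y) \in Q -> R (s^-1%g e) (s^-1%g y).
  by move=> ey; apply: a2; apply/corr_compP; exists (g e).
have ginj : injective g.
  move=> e e' ee; apply: (@perm_inj _ s^-1%g); apply: Ranti.
  by rewrite !gR // (ee, esym ee).
exists (perm ginj); split; apply/fund_permP; split=> [e|x y].
- by rewrite permE.
- by rewrite permE; apply: gR.
- by have := gP ((perm ginj)^-1%g e); rewrite -{1}(permE ginj) permKV permM.
rewrite invMg !permM => xy; apply: a2; apply/corr_compP; exists y; split=> //.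
by have := gQ ((perm ginj)^-1%g y); rewrite -{1}(permE ginj) permKV.
Qed.

Lemma fund_act_comp P Q x :
  fund_act k R (corr_comp P Q) x = fund_act k R P (fund_act k R Q x).
Proof.
rewrite -comp_lfunE; congr (fun_of_lfun _ x); apply: freemod_ext => s.
rewrite comp_lfunE.
have [/existsP[c cQ]|] := boolP [exists c, fund_perm R Q s c]; last first.
  rewrite negb_exists => /forallP nQ; rewrite (fund_act_base0 nQ) linear0.
  apply: fund_act_base0 => a; apply/negP => /fund_perm_factor[c [cQ _]].
  by move: (nQ c); rewrite cQ.
rewrite (fund_act_base cQ).
have [/existsP[b bP]|] := boolP [exists b, fund_perm R P (s * c)%g b].
  by rewrite (fund_act_base bP) (fund_act_base (fund_perm_mul cQ bP)) mulgA.
rewrite negb_exists => /forallP nP; rewrite (fund_act_base0 nP).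
apply: fund_act_base0 => a; apply/negP => /fund_perm_factor[c' [cQ' bP]].
by move: (nP (c'^-1 * a)%g); rewrite -(fund_perm_uniq cQ' cQ) bP.
Qed.

Lemma fund_act_sum Q : fund_act k R Q (fbase k 1%g) =
  \sum_b (fund_perm R Q 1%g b)%:R *: fbase k b.
Proof.
have [/existsP[b bQ]|] := boolP [exists b, fund_perm R Q 1%g b].
  rewrite (fund_act_base bQ) mul1g (bigD1 b) //= bQ scale1r big1 ?addr0 // => c cb.
  suff /negbTE-> : ~~ fund_perm R Q 1%g c by rewrite scale0r.
  by apply: contra cb => cQ; rewrite (fund_perm_uniq cQ bQ).
rewrite negb_exists => /forallP nQ; rewrite fund_act_base0 // big1 // => b _.
by rewrite (negbTE (nQ b)) scale0r.
Qed.

Lemma fund_act_diag s : fund_act k R (diag_perm s) (fbase k 1%g) = fbase k s.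
Proof.
rewrite (@fund_act_base _ _ s) ?mul1g //; apply/fund_permP; split=> [e|x y].
  exact: imset_f.
by case/imsetP=> e _ [/perm_inj-> ->].
Qed.

Variables (n : nat) (rG : mx_representation k (autrel R) n) (X : finType).

Local Notation bt := (btens (mem (autrel R)) (@fund_ract k E) (rep_act rG)).

Lemma bt_linearl v : linear (bt^~ v).
Proof.
move=> a x y; have [tl _] := tens_bilin (fundmod k E) 'rV[k]_n.
by rewrite /btens tl linearP.
Qed.

Lemma bt_linearr x : linear (bt x).
Proof.
move=> a v w; have [_ tr] := tens_bilin (fundmod k E) 'rV[k]_n.
by rewrite /btens tr linearP.
Qed.

Lemma fundV_act_comp P Q w :
  fundV_act rG (corr_comp P Q) w = fundV_act rG P (fundV_act rG Q w).
Proof.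
suff -> : fundV_act rG (corr_comp P Q) = (fundV_act rG P \o fundV_act rG Q)%VF.
  exact: comp_lfunE.
apply: btens_ext => x v; apply: etrans (fundV_actE rG _ x v) _.
rewrite fund_act_comp; apply/esym; apply: etrans (comp_lfunE _ _ _) _.
apply: etrans (congr1 _ (fundV_actE rG Q x v)) _; exact: fundV_actE.
Qed.

(** The class of phi (x) (f_R (x) v), where f_R is the basis vector of the identity permutation. *)
Definition Sclass (phi : corr X E) (v : 'rV[k]_n) : Sfun rG X :=
  quot_proj _ (Ltens (fundV_act rG) (fbase k phi) (bt (fbase k 1%g) v)).

Lemma Ltens_linearr x : linear (@Ltens k E _ (fundV_act rG) X x).
Proof.
move=> a v w; have [_ tr] := tens_bilin (kcorr k X E) (fundV rG).
by rewrite /Ltens /btens tr linearP.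
Qed.

Lemma Sclass_linear phi : linear (Sclass phi).
Proof. by move=> a v w; rewrite /Sclass bt_linearr Ltens_linearr linearP. Qed.

(** Associativity and the module law make [Jeval] balanced, so it descends to L and then, by the
    choice of J, to the map [Sval] on S. *)
Lemma Jeval_bal (rho : corr E X) v :
  v \in bal_rel predT (@corr_ract k E X) (fundV_act rG) ->
  Jeval (fundV_act rG) (fbase k rho) v = 0.
Proof.
apply: bal_rel_ker => Q x w _; rewrite !JevalE.
have [al _] := kact_bilin (fundV_act rG); have [_ cr] := @kcomp_bilin k E X E.
have lf : linear (fun y => kact (fundV_act rG)
    (kcomp (fbase k rho) (corr_ract k X Q y)) w).
  by move=> a y z; rewrite linearP cr al.
have lg : linear (fun y => kact (fundV_act rG)
    (kcomp (fbase k rho) y) (fundV_act rG Q w)).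
  by move=> a y z; rewrite cr al.
rewrite -(linfunE lf) -(linfunE lg); congr (fun_of_lfun _ x).
apply: freemod_ext => phi; rewrite (linfunE lf) (linfunE lg).
rewrite /corr_ract flin_base !kcomp_base.
rewrite /kact !flin_base corr_compA.
exact: fundV_act_comp.
Qed.

Definition Sval (rho : corr E X) : 'Hom(Sfun rG X, fundV rG) :=
  (Jeval (fundV_act rG) (fbase k rho) \o quot_repr _ \o quot_repr _)%VF.

Lemma SvalE rho t :
  Sval rho (quot_proj _ (quot_proj _ t)) = Jeval (fundV_act rG) (fbase k rho) t.
Proof.
rewrite /Sval quot_liftE => [|v].
  exact: quot_liftE (@Jeval_bal rho).
case/memv_imgP=> u uJ ->; rewrite (quot_liftE _ (@Jeval_bal rho)).
by move/subv_bigcapP: uJ => /(_ rho isT); rewrite -memvE memv_ker => /eqP.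
Qed.

(** J consists of the classes killed by every rho, so the evaluations together separate the points
    of S. *)
Lemma Sval_inj x : (forall rho, Sval rho x = 0) -> x = 0.
Proof.
move=> x0; rewrite -[x]quot_reprK -[quot_repr _ x]quot_reprK.
set t := quot_repr _ (quot_repr _ x); apply/eqP; rewrite quot_proj_eq0.
apply: memv_img; rewrite memvE; apply/subv_bigcapP => rho _.
rewrite -memvE memv_ker -SvalE; apply/eqP.
by rewrite /t !quot_reprK; apply: x0.
Qed.

Lemma Sval_class rho phi v : Sval rho (Sclass phi v) =
  \sum_b (fund_perm R (corr_comp rho phi) 1%g b)%:R *: bt (fbase k b) v.
Proof.
rewrite /Sclass /Ltens [btens predT _ _ _ _]/btens SvalE JevalE kcomp_base.
rewrite /kact flin_base fundV_actE fund_act_sum.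
by rewrite (linear_comb (bt_linearl v)).
Qed.

Definition coset_bilin (x : fundmod k E) (v : 'rV[k]_n) : 'rV[k]_n :=
  flin (fun s => if s \in autrel R then v *m rG s else 0) x.

Lemma coset_bilinP : bilin coset_bilin.
Proof.
split=> [v|x] a y z; first by rewrite /coset_bilin linearP.
rewrite /coset_bilin !flinE scaler_sumr -big_split; apply: eq_bigr => s _ /=.
by case: ifP => _; rewrite ?scaler0 ?addr0 // mulmxDl -scalemxAl scalerDr !scalerA mulrC.
Qed.

(* The component of the identity coset in fundV, the sum over the cosets of
   Aut(E, R) of copies of V. *)
Definition idcoset : 'Hom(fundV rG, 'rV[k]_n) :=
  (tens_lift coset_bilin \o quot_repr _)%VF.

Lemma idcosetE s v :
  idcoset (bt (fbase k s) v) = if s \in autrel R then v *m rG s else 0.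
Proof.
rewrite /idcoset quot_liftE.
  by rewrite (tens_liftE coset_bilinP) /coset_bilin flin_base.
apply: bal_rel_ker => d x w dA; rewrite !(tens_liftE coset_bilinP).
rewrite /coset_bilin -comp_lfunE; congr (fun_of_lfun _ x).
apply: freemod_ext => t; rewrite comp_lfunE /fund_ract !flin_base groupMl //.
by case: ifP => // tA; rewrite /rep_act lfunE /= (repr_mxM rG (dA : d \in autrel R) tA) mulmxA.
Qed.

(** Delta_s f_R is the relation Delta_s applied to f_R, and this relation moves across the tensor
    sign. Hence the classes [Sclass phi v] span S. *)
Lemma Ltens_diag phi s v :
  Ltens (fundV_act rG) (fbase k phi) (bt (fbase k s) v) =
  Ltens (fundV_act rG) (fbase k (corr_comp phi (diag_perm s))) (bt (fbase k 1%g) v)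
  :> Lfun (fundV_act rG) X.
Proof.
rewrite -kcomp_base Ltens_bal /kact flin_base fundV_actE.
by rewrite fund_act_diag.
Qed.

Lemma Sclass_span (U : {vspace Sfun rG X}) :
  (forall phi v, Sclass phi v \in U) -> U = fullv.
Proof.
move=> SU; apply/eqP; rewrite eqEsubv subvf; apply/subvP => x _; rewrite -quot_proj_eq0.
suff -> : quot_proj U = 0 by rewrite zero_lfunE.
apply: quot_ext => y; rewrite zero_lfunE.
pose F := (quot_proj U \o quot_proj (Jfun (fundV_act rG) X))%VF.
suff F0 : F = 0.
  by have := congr1 (fun g : 'Hom(_, _) => g y) F0; rewrite comp_lfunE zero_lfunE.
have Fd phi w : F (Ltens (fundV_act rG) (fbase k phi) w) = 0.
  have lf : linear (fun w => F (Ltens (fundV_act rG) (fbase k phi) w)).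
    by move=> a u v; rewrite Ltens_linearr linearP.
  rewrite -(linfunE lf) [linfun _](_ : _ = 0) ?zero_lfunE //.
  apply: btens_ext => z v; rewrite (linfunE lf) zero_lfunE.
  rewrite [z]freemod_span (linear_comb (bt_linearl v)) (linear_comb lf) big1 // => s _.
  rewrite Ltens_diag comp_lfunE; apply/eqP; rewrite scaler_eq0 quot_proj_eq0.
  by rewrite [_ \in _]SU orbT.
apply: btens_ext => z w; rewrite zero_lfunE -/(Ltens (fundV_act rG) z w).
have lf : linear (fun z => F (Ltens (fundV_act rG) z w)).
  move=> a u v; have [tl _] := tens_bilin (kcorr k X E) (fundV rG).
  by rewrite /Ltens /btens tl !linearP.
by rewrite [z]freemod_span (linear_comb lf) big1 // => phi _; rewrite Fd scaler0.
Qed.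

End Poset.
End ModuleLemmas.

(** * The dimension *)

Section LatticeAut.
Variables (d : Order.disp_t) (T : finTBLatticeType d) (a : {perm T}).
Hypothesis aT : a \in autrel (<=%O : rel T).
Local Open Scope order_scope.
Implicit Types s t : T.

Lemma aut_le s t : (a s <= a t) = (s <= t).
Proof. by move/autrelP: aT. Qed.

Lemma aut_lt s t : (a s < a t) = (s < t).
Proof. by rewrite !lt_neqAle aut_le (inj_eq perm_inj). Qed.

Lemma aut_leV s t : (a^-1%g s <= t) = (s <= a t).
Proof. by rewrite -(aut_le (a^-1%g s)) permKV. Qed.

Lemma aut_geV s t : (s <= a^-1%g t) = (a s <= t).
Proof. by rewrite -(aut_le s) permKV. Qed.

Lemma aut_rmap t : rmap (a t) = a (rmap t).
Proof.
apply/le_anti/andP; split.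
  apply/joinsP => s st; rewrite -aut_leV; apply: joins_sup.
  by rewrite -aut_lt permKV.
by rewrite -aut_geV; apply/joinsP => s st; rewrite aut_geV; apply: joins_sup; rewrite aut_lt.
Qed.

Lemma aut_irr t : irreducible (a t) = irreducible t.
Proof.
apply/idP/idP; last exact: aut_irreducible.
by rewrite -{2}[t](permK a); apply: aut_irreducible; rewrite groupV.
Qed.

Lemma aut_sigma t : sigma (a t) = a (sigma t).
Proof.
apply/le_anti/andP; split.
  rewrite -aut_leV; apply/meetsP => e /andP[eI te].
  by rewrite aut_leV; apply: meets_inf; rewrite aut_irr aut_lt eI.
apply/meetsP => e /andP[eI te]; rewrite -aut_geV; apply: meets_inf.
by rewrite -aut_irr -aut_lt permKV eI.
Qed.

Lemma aut_bulb t : bulb (a t) = bulb t.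
Proof.
have rE s : rinf (a s) = a (rinf s).
  by rewrite /rinf /stable; elim: #|T| => //= n ->; rewrite aut_rmap.
have sE s : sigmainf (a s) = a (sigmainf s).
  by rewrite /sigmainf /stable; elim: #|T| => //= n ->; rewrite aut_sigma.
by rewrite /bulb sE rE (inj_eq perm_inj).
Qed.

End LatticeAut.

(** * Correspondences as rows and columns of the matrix, and the action of Aut(T) *)

Section Evaluation.
Variables (dE dT : Order.disp_t) (E : finPOrderType dE) (T : finTBLatticeType dT).
Variables (i : E -> T) (X : finType) (irrT : is_Irr i).
Implicit Types (f : {ffun X -> T}) (rho : corr E X) (phi : corr X E) (a : {perm T}).

Definition rowmap rho (b : {perm E}) : {ffun X -> {set E}} :=
  [ffun x => [set e | (b e, x) \in rho]].

Definition joinmap phi : {ffun X -> T} :=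
  [ffun x => (\join_(e | (x, e) \in phi) i e)%O].

(** The largest correspondence whose join map is f. *)
Definition lowermap f : corr X E := [set p | (i p.2 <= f p.1)%O].

Lemma lowermapK f : joinmap (lowermap f) = f.
Proof.
apply/ffunP => x; rewrite ffunE; apply/le_anti/andP; split.
  by apply/joinsP => e; rewrite inE.
rewrite [leLHS](join_irreducible (f x)); apply/joinsP => t /andP[/(irr_codom irrT)[e ->]].
by move=> ex; apply: joins_sup; rewrite inE.
Qed.

(** The upper inclusion in [fund_perm] says that every e with (b e, x) in rho bounds the join of
    phi_x. Under this bound, (x, e) in phi amounts to the join being [i e], by irreducibility. *)
Lemma fund_perm_col rho phi b :
  fund_perm (oprel (<=%O : rel E)) (corr_comp rho phi) 1%g b =
  col i (joinmap phi) (rowmap rho b).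
Proof.
apply/(fund_permP (oprel (<=%O : rel E)))/andP => -[h1 h2].
  have le_x x e : (b e, x) \in rho -> (joinmap phi x <= i e)%O.
    move=> ex; rewrite ffunE; apply/joinsP => e' xe'; rewrite (irr_mono irrT).
    have := h2 e e'; rewrite /oprel invg1 !perm1; apply.
    by apply/corr_compP; exists x.
  split; apply/forallP; [move=> x|move=> e].
    by apply/forall_inP => e; rewrite ffunE inE; apply: le_x.
  have /corr_compP[x [ex xe]] := h1 e; apply/existsP; exists x.
  rewrite [rowmap _ _ _]ffunE inE ex andbT; apply/eqP/le_anti; rewrite le_x //=.
  by rewrite ffunE; apply: joins_sup.
split=> [e|e e'].
  move/forallP/(_ e)/existsP: h2 => [x /andP[/eqP xe]]; rewrite ffunE inE => ex.
  apply/corr_compP; exists x; split=> //; apply: contraT => nxe.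
  (* The irreducible [i e] is a join of elements of A, so it is one of them. *)
  pose A := [set i e' | e' in [set e' | (x, e') \in phi]].
  have := irr_i irrT e; rewrite /irreducible => /forallP/(_ A).
  move: xe; rewrite ffunE => xe; rewrite -{1}xe.
  have -> : (\join_(e' | (x, e') \in phi) i e' = \join_(t in A) t)%O.
    apply/le_anti/andP; split; apply/joinsP; [move=> e' xe'|move=> t /imsetP[e']].
      by apply: joins_sup; rewrite imset_f // inE.
    by rewrite inE => xe' ->; apply: joins_sup.
  by rewrite eqxx => /imsetP[e']; rewrite inE => xe' /(irr_inj irrT) ee; rewrite ee xe' in nxe.
rewrite /oprel invg1 !perm1 => /corr_compP[x [ex xe]]; rewrite -(irr_mono irrT).
move/forallP/(_ x)/forall_inP/(_ e): h1; rewrite ffunE inE ex => /(_ isT).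
by apply: le_trans; rewrite ffunE; apply: joins_sup.
Qed.

Definition postact f a : {ffun X -> T} := [ffun x => a (f x)].

Lemma postact_1 : postact^~ 1%g =1 id.
Proof. by move=> f; apply/ffunP => x; rewrite ffunE perm1. Qed.

Lemma postactM f : act_morph postact f.
Proof. by move=> a b; apply/ffunP => x; rewrite !ffunE permM. Qed.

Definition post : {action {perm T} &-> {ffun X -> T}} := TotalAction postact_1 postactM.

Local Notation AutT := (autrel (<=%O : rel T)).

Lemma post_colbasis a f : a \in AutT -> f \in colbasis i X -> post f a \in colbasis i X.
Proof.
move=> aT; rewrite !inE => /andP[/forallP fE /forallP fG].
apply/andP; split; apply/forallP; [move=> e|move=> x].
  have /existsP[x /eqP xe] := fE (restr i a^-1%g e); apply/existsP; exists x.
  by rewrite /= ffunE xe (restrE irrT) ?groupV // permKV.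
rewrite ffunE; have := fG x; rewrite !inE -!/(bulb _) aut_bulb //.
case/orP=> [/imsetP[e _ ->]|->]; last by rewrite orbT.
by rewrite -(restrE irrT aT) imset_f.
Qed.

(** All of E occurs among the values of f, so an automorphism fixing f restricts to the identity of
    E. *)
Lemma post_free a f : {in AutT &, injective (restr i)} -> a \in AutT ->
  f \in colbasis i X -> post f a = f -> a = 1%g.
Proof.
move=> rinj aT; rewrite inE => /andP[/forallP fE _] fa; apply: rinj => //.
apply/permP => e; apply: (irr_inj irrT); rewrite !(restrE irrT) ?group1 // perm1.
have /existsP[x /eqP <-] := fE e.
by have := congr1 (fun g : {ffun X -> T} => g x) fa; rewrite ffunE.
Qed.

(** Since a preserves the order and sends [i e] to [i (restr i a e)], moving the values of f by a
    relabels the elements of E in the row. *)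
Lemma col_post a f rho b : a \in AutT ->
  col i (post f a) (rowmap rho b) = col i f (rowmap rho (restr i a * b)%g).
Proof.
move=> aT; set h := restr i a.
have hK e : i (h e) = a (i e) by rewrite /h (restrE irrT aT).
congr andb; apply/forallP/forallP => H; [move=> x|move=> x|move=> e|move=> e].
- apply/forall_inP => e; rewrite ffunE inE permM => ex.
  move/forall_inP: (H x) => /(_ (h e)); rewrite !ffunE inE hK => /(_ ex).
  by rewrite aut_le.
- apply/forall_inP => e; rewrite !ffunE inE => ex.
  rewrite -[e](permKV h) hK aut_le //.
  by move/forall_inP: (H x); apply; rewrite ffunE inE permM permKV.
- have /existsP[x] := H (h e); rewrite !ffunE inE hK (inj_eq perm_inj) => xe.
  by apply/existsP; exists x; rewrite ffunE inE permM.
have /existsP[x] := H (h^-1%g e); rewrite ffunE inE permM permKV => /andP[/eqP xe ex].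
by apply/existsP; exists x; rewrite !ffunE inE ex xe -hK permKV eqxx.
Qed.

End Evaluation.

(** * The dimension of S from the free orbits of Aut(T) on [colbasis] *)

Section Dimension.
Variables (k : fieldType) (dE dT : Order.disp_t) (E : finPOrderType dE).
Variables (T : finTBLatticeType dT) (i : E -> T) (X : finType).
Hypothesis irrT : is_Irr i.
Local Notation AutT := (autrel (<=%O : rel T)).
Local Notation R := (oprel (<=%O : rel E)).
Hypotheses (rinj : {in AutT &, injective (restr i)}).
Hypotheses (rim : restr i @: AutT = autrel R).
Variables (n : nat) (rG : mx_representation k (autrel R) n).

Local Notation B := (colbasis i X).
Local Notation S := (Sfun rG X).
Local Notation bt := (btens (mem (autrel R)) (@fund_ract k E) (rep_act rG)).
Local Notation reps := (orbit_transversal (post T X) AutT B).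

Let opanti : antisymmetric R.
Proof. by move=> x y /andP[yx xy]; apply/le_anti/andP. Qed.

Let optrans : transitive R.
Proof. by move=> y x z /[swap]; apply: le_trans. Qed.

Let oprefl : reflexive R. Proof. by move=> x; apply: lexx. Qed.

Lemma restr_autrel a : a \in AutT -> restr i a \in autrel R.
Proof. by move=> aT; rewrite -rim imset_f. Qed.

Lemma sum_restr (F : {perm E} -> k) :
  \sum_(b in autrel R) F b = \sum_(a in AutT) F (restr i a).
Proof. by rewrite -rim big_imset. Qed.

Definition fclass (f : {ffun X -> T}) v : S := Sclass rG (lowermap i f) v.

Lemma Sval_Sclass rho phi v : Sval rG rho (Sclass rG phi v) =
  \sum_b (col i (joinmap i phi) (rowmap (X := X) rho b))%:R *: bt (fbase k b) v.
Proof.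
by rewrite (Sval_class opanti optrans); under eq_bigr do rewrite (fund_perm_col irrT).
Qed.

Lemma Sval_fclass rho f v : Sval rG rho (fclass f v) =
  \sum_b (col i f (rowmap (X := X) rho b))%:R *: bt (fbase k b) v.
Proof. by rewrite /fclass Sval_Sclass (lowermapK irrT). Qed.

Lemma Sval_ext (x y : S) : (forall rho, Sval rG rho x = Sval rG rho y) -> x = y.
Proof.
move=> xy; apply/eqP; rewrite -subr_eq0; apply/eqP.
by apply: (Sval_inj opanti optrans) => rho; rewrite linearB /= xy subrr.
Qed.

(** The evaluations see phi only through its join map, whose column is a combination of basis
    columns with coefficients independent of the row. *)
Lemma Sclass_joinmap phi v : exists c : {ffun X -> T} -> k,
  Sclass rG phi v = \sum_(f in B) c f *: fclass f v.
Proof.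
have [c hc] := spanned_all irrT k (joinmap i phi); exists c.
apply: Sval_ext => rho; rewrite Sval_Sclass linear_sum.
under [RHS]eq_bigr do rewrite linearZ /= Sval_fclass scaler_sumr.
rewrite exchange_big; apply: eq_bigr => b _ /=; rewrite hc scaler_suml.
by apply: eq_bigr => f _; rewrite scalerA.
Qed.

(** The sum over b is reindexed by [restr i a], which then passes through the balanced tensor
    product to act on v. *)
Lemma fclass_post f a v : a \in AutT ->
  fclass (post T X f a) v = fclass f (v *m rG (restr i a)^-1%g).
Proof.
move=> aT; apply: Sval_ext => rho; rewrite !Sval_fclass.
have hR := restr_autrel aT; set h := restr i a in hR *.
rewrite (reindex_inj (mulgI h^-1%g)); apply: eq_bigr => b _ /=.
rewrite (col_post irrT) // -/h mulKVg; congr (_ *: _).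
have hV : h^-1%g \in mem (autrel R) by rewrite groupV.
have := btens_bal (@fund_ract k E) (rep_act rG) (fbase k b) v hV.
by rewrite /fund_ract flin_base /rep_act lfunE.
Qed.

Lemma acts_colbasis : [acts AutT, on B | post T X].
Proof.
apply/actsP => a aT f; apply/idP/idP => h; last exact: post_colbasis.
by rewrite -[f](actK (post T X) a); apply: post_colbasis; rewrite ?groupV.
Qed.

Lemma card_colbasis : (#|B| = #|reps| * #|AutT|)%N.
Proof.
have [tr _ _ _] := orbit_transversalP acts_colbasis.
rewrite (card_transversal tr); apply: card_uniform_partition.
  move=> _ /imsetP[f fB ->]; rewrite -(card_orbit_stab (post T X) AutT f).
  suff -> : 'C_AutT[f | post T X]%g = 1%g by rewrite cards1 muln1.
  apply/trivgP/subsetP => a /setIP[aT /astab1P fa]; rewrite inE; apply/eqP.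
  exact: post_free rinj aT fB fa.
exact: orbit_partition acts_colbasis.
Qed.

(** The isomorphism onto S from a sum of copies of V, one for each orbit: row j of M is the vector
    at the j-th representative. *)
Definition repsum (M : 'M[k]_(#|reps|, n)) : S :=
  \sum_j fclass (enum_val j) (row j M).

Lemma repsum_linear : linear repsum.
Proof.
move=> a M N; rewrite /repsum scaler_sumr -big_split; apply: eq_bigr => j _ /=.
by rewrite linearP /fclass Sclass_linear.
Qed.

Lemma reps_colbasis f : f \in reps -> f \in B.
Proof. by have [_ /subsetP h _ _] := orbit_transversalP acts_colbasis => /h. Qed.

Lemma reps_post f g a : f \in reps -> g \in reps -> a \in AutT ->
  post T X f a = g -> f = g /\ a = 1%g.
Proof.
move=> fr gr aT fa; have [_ _ h _] := orbit_transversalP acts_colbasis.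
have /eqP fg : f == g by rewrite -h // -fa mem_orbit.
split=> //; apply: (post_free irrT rinj aT (reps_colbasis fr)).
by rewrite fa fg.
Qed.

Lemma repsum_eq0 M : repsum M = 0 -> M = 0.
Proof.
move=> M0; apply/matrixP => j l; rewrite mxE.
(* The l-th coordinate of the identity-coset component of [repsum M] is a combination of columns;
   [c f] collects the coefficient of the column f. Freeness of the action on distinct orbits makes
   it [M j l] at the j-th representative. *)
pose c f : k := \sum_j' \sum_(a in AutT)
  (post T X (enum_val j') a == f)%:R * (row j' M *m rG (restr i a)) 0 l.
have c0 U : \sum_(f in B) c f * (col i f U)%:R = 0.
  pose rho : corr E X := [set p | p.1 \in U p.2].
  have UE : U = rowmap (X := X) rho 1%g.
    by apply/ffunP => x; apply/setP => e; rewrite ffunE !inE perm1.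
  have := congr1 (fun x => (idcoset rG (Sval rG rho x)) 0 l) M0.
  rewrite !linear0 mxE => M0'; rewrite -[RHS]M0' /repsum !linear_sum summxE.
  under eq_bigr do rewrite /c mulr_suml.
  rewrite exchange_big; apply: eq_bigr => j' _ /=.
  under eq_bigr do rewrite mulr_suml.
  rewrite exchange_big Sval_fclass linear_sum summxE /=.
  rewrite [RHS](bigID (mem (autrel R))) /= [X in _ + X]big1 ?addr0; last first.
    by move=> b /negbTE nb; rewrite linearZ /= idcosetE nb scaler0 mxE.
  apply: (etrans _ (esym (sum_restr _))); apply: eq_bigr => a aT.
  rewrite (bigD1 (post T X (enum_val j') a)) /=; last first.
    by rewrite post_colbasis // reps_colbasis // enum_valP.
  rewrite eqxx mul1r big1 ?addr0; last first.
    by move=> f /andP[_ /negbTE]; rewrite eq_sym => ->; rewrite !mul0r.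
  rewrite linearZ /= idcosetE restr_autrel // [RHS]mxE mulrC UE (col_post irrT) //.
  by rewrite mulg1.
have jB := reps_colbasis (enum_valP j).
have := col_free irrT c0 jB; rewrite /c (bigD1 j) //=.
rewrite (bigD1 1%g) /=; last exact: (group1 AutT).
rewrite big1 ?addr0 => [|a /andP[aT a1]]; last first.
  case: eqP => [/(reps_post (enum_valP j) (enum_valP j) aT)[_ a1']|]; last by rewrite mul0r.
  by rewrite a1' eqxx in a1.
rewrite big1 ?addr0 => [|j' jj]; last first.
  rewrite big1 // => a aT; case: eqP => [|]; last by rewrite mul0r.
  case/(reps_post (enum_valP j') (enum_valP j) aT) => /enum_val_inj jj' _.
  by rewrite jj' eqxx in jj.
have -> : restr i 1%g = 1%g.
  by apply/permP => e; apply: (irr_inj irrT); rewrite (restrE irrT) ?group1 // !perm1.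
by rewrite postact_1 eqxx mul1r (repr_mx1 rG) mulmx1 mxE.
Qed.

(** The classes [fclass f v] with f in [colbasis] span S, and [fclass_post] moves f to the
    representative of its orbit at the cost of changing v. *)
Lemma repsum_full : limg (linfun repsum) = fullv.
Proof.
have rep_in f v : f \in reps -> fclass f v \in limg (linfun repsum).
  move=> fr; pose j := enum_rank_in fr f.
  have -> : fclass f v = linfun repsum (delta_mx j 0 *m v).
    rewrite (linfunE repsum_linear) /repsum (bigD1 j) //= enum_rankK_in //.
    rewrite big1 ?addr0 => [|j' jj].
      rewrite row_mul rowE mul_delta_mx -[v in LHS]mul1mx; congr (fclass _ (_ *m _)).
      by apply/rowP => z; rewrite !mxE !ord1 !eqxx.
    rewrite row_mul rowE mul_delta_mx_0 // mul0mx.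
    by rewrite /fclass -(linfunE (Sclass_linear rG _)) linear0.
  exact: memv_img (memvf _).
apply: (Sclass_span oprefl opanti) => phi v.
have [c ->] := Sclass_joinmap phi v; apply: memv_suml => f fB; apply: memvZ.
have [_ _ _ /(_ f fB)[a aT fr]] := orbit_transversalP acts_colbasis.
have := fclass_post (post T X f a) v (groupVr aT).
rewrite (actK (post T X)) => ->.
exact: rep_in.
Qed.

Lemma dim_Sfun : (\dim {:S} * #|AutT| = n * #|B|)%N.
Proof.
rewrite -repsum_full limg_dim_eq; last first.
  apply/eqP; rewrite capfv -subv0; apply/subvP => M.
  by rewrite memv_ker (linfunE repsum_linear) => /eqP/repsum_eq0->; rewrite mem0v.
by rewrite dimvf dim_matrix card_colbasis mulnAC mulnC.
Qed.

End Dimension.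

(** Inclusion-exclusion over the subsets J of E: the maps from X to G avoiding J number (|G| -
    |J|)^|X|, and the subsets are grouped by size. *)
Lemma card_colbasisE (dE dT : Order.disp_t) (E : finPOrderType dE)
    (T : finTBLatticeType dT) (i : E -> T) (X : finType) : is_Irr i ->
  #|colbasis i X|%:R = \sum_(j < #|E|.+1)
    (-1) ^+ j * 'C(#|E|, j)%:R * (#|Gset i|%:R - j%:R) ^+ #|X| :> rat.
Proof.
move=> irrT; pose G := Gset i; pose D (J : {set E}) := G :\: (i @: J).
have cardD (J : {set E}) : #|D J|%:R = #|G|%:R - #|J|%:R :> rat.
  have JG : i @: J \subset G.
    by apply/subsetP => _ /imsetP[e _ ->]; rewrite inE imset_f.
  rewrite cardsD (setIidPr JG) card_imset; last exact: irr_inj.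
  by rewrite natrB // -(card_imset _ (irr_inj irrT)) subset_leq_card.
transitivity (\sum_(J : {set E}) (-1) ^+ #|J| * (#|G|%:R - #|J|%:R) ^+ #|X| : rat); last first.
  (* [inord] is exact here because |J| <= |E|. *)
  rewrite (partition_big (fun J : {set E} => inord #|J| : 'I_#|E|.+1) xpredT) //=.
  apply: eq_bigr => j _; rewrite -card_draws.
  have cardJ (J : {set E}) : (inord #|J| == j) = (J \in [set A : {set E} | #|A| == j]).
    by rewrite inE -val_eqE /= inordK // ltnS max_card.
  under eq_bigl do rewrite cardJ.
  rewrite (eq_bigr (fun=> (-1) ^+ j * (#|G|%:R - j%:R) ^+ #|X|)); last first.
    by move=> J; rewrite inE => /eqP->.
  by rewrite sumr_const -[LHS]mulr_natr mulrAC.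
pose hit (f : {ffun X -> T}) e := [exists x, f x == i e].
transitivity (\sum_(f : {ffun X -> T} | [forall x, f x \in G])
    \prod_e (hit f e)%:R : rat).
  under [RHS]eq_bigr do rewrite prod_natb.
  rewrite -sum1_card natr_sum (eq_bigl (fun f : {ffun X -> T} =>
    [forall x, f x \in G] && [forall e, hit f e])).
    by rewrite big_mkcondr; apply: eq_bigr => f _; case: [forall e, _].
  by move=> f; rewrite inE andbC.
(* Here b = true is the term in which the value [i e] is avoided; the set J collects these e. *)
have hitE f e : (hit f e)%:R = \sum_(b : bool) (-1) ^+ b * (b ==> ~~ hit f e)%:R :> rat.
  by rewrite big_bool /= expr0 expr1 mul1r mulN1r; case: (hit f e);
    rewrite ?subr0 ?oppr0 ?add0r ?addNr.
under eq_bigr do rewrite (eq_bigr _ (fun e _ => hitE _ e)) bigA_distr_bigA.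
rewrite exchange_big /= (reindex (fun J : {set E} => [ffun e => e \in J])) /=; last first.
  exists (fun F : {ffun E -> bool} => [set e | F e]) => [J|F] _.
    by apply/setP => e; rewrite inE ffunE.
  by apply/ffunP => e; rewrite ffunE inE.
apply: eq_bigr => J _; rewrite -cardD -natrX.
have -> : (#|D J| ^ #|X|)%:R = \sum_(f : {ffun X -> T} | f \in ffun_on (mem (D J))) 1 :> rat.
  by rewrite sumr_const card_ffun_on.
rewrite mulr_sumr.
under eq_bigr do rewrite big_split /=.
rewrite big_mkcond [RHS]big_mkcond /=; apply: eq_bigr => f _.
have -> : \prod_e (-1) ^+ [ffun e => e \in J] e = (-1) ^+ #|J| :> rat.
  rewrite -prodr_const [RHS]big_mkcond; apply: eq_bigr => e _.
  by rewrite ffunE; case: (e \in J).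
rewrite prod_natb; have -> : (f \in ffun_on (mem (D J))) =
    [forall x, f x \in G] && [forall e, [ffun e => e \in J] e ==> ~~ hit f e].
  apply/ffun_onP/andP => [fD|[/forallP fG /forallP fJ] x].
    split; apply/forallP; first by move=> x; have := fD x; rewrite inE => /andP[].
    move=> e; rewrite ffunE; apply/implyP => eJ; apply/existsP => -[x /eqP fx].
    by have := fD x; rewrite inE fx imset_f.
  rewrite [_ \in _]inE [_ \in Gset _]fG andbT; apply/imsetP => -[e eJ fx].
  by have := fJ e; rewrite ffunE eJ => /existsP[]; exists x; rewrite fx.
by case: [forall x, _]; case: [forall e, _]; rewrite /= ?mulr1 ?mulr0.
Qed.

Theorem theorem6p11 (k : fieldType)
  (dE : Order.disp_t) (E : finPOrderType dE)
  (n : nat) (V : mx_representation k (autrel (<=%O : rel E)) n)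
  (simpleV : mx_irreducible V)
  (dT : Order.disp_t) (T : finTBLatticeType dT) (i : E -> T)
  (irrT : is_Irr i)
  (isoT : misom (autrel (<=%O : rel T)) (autrel (<=%O : rel E)) (restr i))
  (X : finType) :
  (\dim {: Sfun (eqg_repr V (autrel_op (<=%O : rel E))) X})%:R =
    n%:R / #|autrel (<=%O : rel E)|%:R *
    \sum_(j < #|E|.+1)
      (-1) ^+ j * 'C(#|E|, j)%:R * (#|Gset i|%:R - j%:R) ^+ #|X| :> rat.
Proof.
have [fM /isomP[injf imf]] := misomP isoT.
have rinj : {in autrel (<=%O : rel T) &, injective (restr i)}.
  by move=> a b aT bT ab; apply: (injmP injf).
have rim : restr i @: autrel (<=%O : rel T) = autrel (oprel (<=%O : rel E)).
  by rewrite -(eqP (autrel_op _)) -imf morphimEdom.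
have := dim_Sfun X irrT rinj rim (eqg_repr V (autrel_op _)).
rewrite -(card_colbasisE X irrT) -(card_in_imset rinj) rim -(eqP (autrel_op _)).
move=> dimS; rewrite mulrAC -natrM -dimS natrM mulfK //.
by rewrite Num.Theory.pnatr_eq0 -lt0n cardG_gt0.
Qed.
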